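(* Let $1<p<\infty$. Let $\Omega=\bigcup_{j\in\mathbb N} I_j\subset\mathbb R$, where the $I_j$ are pairwise disjoint bounded open intervals. Assume that there exist $d\in(0,1)$ and $h\in G_d$ such that $|I_j|=g(j)$ for all $j\in\mathbb N$, where $g(x)=h^{-1}(1/x)$. Let $f(x)=1/h(1/x)$, and let $N(\lambda,\Omega)$ be the eigenvalue counting function of $-(|u'|^{p-2}u')'=\lambda|u|^{p-2}u$ in $\Omega$ with zero Dirichlet boundary conditions on $\partial\Omega$. Then $$N(\lambda,\Omega)=\frac{|\Omega|}{\pi_p}\lambda^{1/p}+\frac{\zeta(d)}{\pi_p^d}f(\lambda^{1/p})+o\big(f(\lambda^{1/p})\big)\qquad\text{as }\lambda\to\infty.$$
   Context: For $0<d<1$, $G_d$ is the class of continuous functions $h:(0,\infty)\to(0,\infty)$ such that: (i) $h$ is strictly increasing, $\lim_{x\to0^+}h(x)=0$ and $\lim_{x\to\infty}h(x)=\infty$; (ii) for every $t>0$, $\lim_{x\to0^+}h(tx)/h(x)=t^d$, uniformly for $t$ in compact subsets of $(0,\infty)$; (iii) $\lim_{x\to0^+}h(x)/x=\infty$. $\mathbb N=\{1,2,3,\dots\}$, $|\cdot|$ is Lebesgue measure on $\mathbb R$, and $\zeta$ is the Riemann zeta function (analytically continued, so that $\zeta(d)$ makes sense for $0<d<1$). The constant $\pi_p$ is $\pi_p=2(p-1)^{1/p}\int_0^1\frac{ds}{(1-s^p)^{1/p}}$. The Dirichlet eigenvalues of the $p$-Laplacian problem $-(|u'|^{p-2}u')'=\lambda|u|^{p-2}u$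 on an interval of length $T$ are $\lambda_k=\pi_p^pk^p/T^p$, $k\in\mathbb N$. For a disjoint union $\Omega=\bigcup_j I_j$ of intervals, $N(\lambda,\Omega)$ is the number of eigenvalues less than or equal to $\lambda$, counted so that $N(\lambda,\Omega)=\sum_{j=1}^\infty N(\lambda,I_j)$, where $N(\lambda,I_j)=\#\{k\in\mathbb N:\pi_p^pk^p/|I_j|^p\le\lambda\}$. *)

(* Defs.v *)
From HB Require Import structures.
From mathcomp Require Export all_boot all_order all_algebra.
From mathcomp Require Export complex.
From mathcomp Require Export all_classical all_reals all_analysis.

Set Implicit Arguments.
Unset Strict Implicit.
Unset Printing Implicit Defensive.

Export Order.TTheory GRing.Theory Num.Theory.
Export numFieldNormedType.Exports.

Local Open Scope classical_set_scope.
Local Open Scope ring_scope.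
Local Open Scope complex_scope.

(* Lets the library's Landau notations be used at [+oo]. *)
Canonical pinfty_filter_on (R : realType) :=
  FilterType (pinfty_nbhs R) (@proper_pinfty_nbhs R).

Section Zeta.
Variable R : realType.

Definition cexp (z : R[i]) : R[i] :=
  (expR (complex.Re z))%:C * (cos (complex.Im z) +i* sin (complex.Im z)).

(* [n ^ (- s)] for [1 <= n] and complex [s]. *)
Definition nat_cpowN (n : nat) (s : R[i]) : R[i] :=
  cexp (- (s * (ln (n%:R : R))%:C)).

(* [f] is the sum of a power series on some disc centred at [c]. *)
Definition analytic_at (f : R[i] -> R[i]) (c : R[i]) : Prop :=
  exists (a : nat -> R[i]) (r : R), 0 < r /\
    forall z : R[i], `|z - c| < r%:C ->
      series (fun k => a k * (z - c) ^+ k : R[i]^o) @ \oo --> (f z : R[i]^o).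

(* By uniqueness of analytic continuation this determines [zeta] at every
   point other than the pole [1]. *)
Definition is_riemann_zeta (zeta : R[i] -> R[i]) : Prop :=
  (forall s : R[i], 1 < complex.Re s ->
     series (fun k => nat_cpowN k.+1 s : R[i]^o) @ \oo --> (zeta s : R[i]^o)) /\
  (forall s : R[i], s != 1 -> analytic_at zeta s).

End Zeta.

Section Counting.
Variable R : realType.

Definition class_G (d : R) (h : R -> R) : Prop :=
  [/\ (forall x : R, 0 < x -> 0 < h x),
      (forall x : R, 0 < x -> {for x, continuous h}),
      [/\ (forall x y : R, 0 < x -> x < y -> h x < h y),
          h x @[x --> 0^'+] --> (0 : R)
        & h x @[x --> +oo] --> +oo],
      (forall K : set R, compact K -> K `<=` `]0, +oo[ ->
         {uniform K, (fun x t => h (t * x) / h x) @ 0^'+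
                     --> (fun t => t `^ d)})
    & h x / x @[x --> 0^'+] --> +oo].

(* The inverse of an increasing bijection [h] of []0, +oo[[ onto itself. *)
Definition inv_pos (h : R -> R) : R -> R := 'pinv_(fun=> 0) (`]0, +oo[ : set R) h.

(* The integrand takes the value [0] at the endpoint [1], where the fraction
   is singular. *)
Definition pi_p (p : R) : R :=
  2 * (p - 1) `^ p^-1 *
  Rintegral lebesgue_measure `[0, 1] (fun s => (1 - s `^ p) `^ (- p^-1)).

(* The [k]-th Dirichlet eigenvalue, [1 <= k], of
   [- (|u'| ^ (p - 2) u')' = lambda |u| ^ (p - 2) u]
   on an interval of length [T]. *)
Definition plap_eigenvalue (p T : R) (k : nat) : R :=
  pi_p p `^ p * k%:R `^ p / T `^ p.

Definition len (A : set R) : R := fine (lebesgue_measure A).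

Definition eigencount_itv (p lambda : R) (J : set R) : \bar R :=
  counting [set k : nat | (1 <= k)%N /\ plap_eigenvalue p (len J) k <= lambda].

(* The counting function of the union of the disjoint intervals [I j],
   [1 <= j]. *)
Definition eigencount (p lambda : R) (I : nat -> set R) : \bar R :=
  (\sum_(1 <= j <oo) eigencount_itv p lambda (I j))%E.

End Counting.

(* Main.v *)
Require Import Defs.
From mathcomp Require Import measurable_realfun.
From mathcomp Require Import ring lra zify.

(* Put x = lambda^(1/p) / pi_p and l_j = |I_j|.  The interval I_j carries
   floor(x l_j) eigenvalues, so N(lambda) = x |Omega| - T(x), where T(x) is the
   sum of the fractional parts {x l_j}, and the claim is T(x) ~ - zeta(d) f(x).
   From 2 {u} = b(u) + {2 u}, with b(u) the first binary digit of {u}, follows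
   2 T(x) = A(x) + T(2 x), where A(x) counts the j with b(x l_j) = 1.  As
   #{j : x l_j >= v} = floor(f(x / v)), regular variation gives
   A(x) / f(x) --> alpha = \sum_k ((k + 1/2)^-d - (k + 1)^-d); since T / f is
   bounded and 2^d < 2, the recursion forces T / f --> alpha / (2 - 2^d).
   Finally alpha = (2^d - 2) zeta(d), because
   (1 - 2^(1-s)) zeta(s) = \sum_n ((2 n + 1)^-s - (2 n + 2)^-s) on Re s > 1 and
   both sides, restricted to the segment from d to 2 + i (which avoids the
   pole), are real-analytic functions of the parameter. *)

Set Implicit Arguments.
Unset Strict Implicit.
Unset Printing Implicit Defensive.

Local Open Scope classical_set_scope.
Local Open Scope ring_scope.
Local Open Scope complex_scope.

(** * Fractional parts and binary digits *)

Section FractionalParts.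
Variable R : realType.
Implicit Types (u x y : R) (n m K : nat).

(** The doubling formula avoids integrating the fractional part against a regularly varying count:
    once $K$ is fixed, only finitely many limits $f(tx)/f(x) \to t^d$ are used and the tail is one
    more level count. Summability of the lengths is not assumed, so the estimates concern partial
    sums over $j \le n$ with bounds independent of $n$; finiteness of $|\Omega|$ is then read off
    from the convergence of $T$ at a single point. For zeta the obstacle is that analyticity is
    given only as local convergence of power series, and that the zeta series diverges at $d$. Each
    power series therefore carries a bound for its weighted coefficient sum. These bounds add and
    multiply, so they can be summed over the pairs of the alternating series, and they yield the
    identity theorem in one real parameter. *)

Definition frac_part u : R := u - (Num.truncn u)%:R.

Definition half_bit u : R := ((Num.truncn u)%:R + 2^-1 <= u)%R%:R.

Lemma frac_part_ge0 u : 0 <= u -> 0 <= frac_part u.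
Proof. by move=> u0; rewrite subr_ge0 truncn_le. Qed.

Lemma frac_part_lt1 u : frac_part u < 1.
Proof. by rewrite ltrBlDl natr1 truncnS_gt. Qed.

Lemma frac_part_double u : 0 <= u ->
  2 * frac_part u = half_bit u + frac_part (2 * u).
Proof.
move=> u0; have /andP[n1 n2] := truncn_itv u0.
rewrite /frac_part /half_bit; set n := Num.truncn u in n1 n2 *.
case: (boolP (n%:R + 2^-1 <= u)) => [h|]; last rewrite -ltNge => h; rewrite /=.
  rewrite (@truncn_def _ (2 * u) n.*2.+1) -?natr1 -muln2 natrM; first by lra.
  by move: n1 n2 h; rewrite -[n.+1%:R]natr1; lra.
rewrite (@truncn_def _ (2 * u) n.*2) -?natr1 -muln2 natrM; first by lra.
by move: n1 n2 h; rewrite -[n.+1%:R]natr1; lra.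
Qed.

Lemma half_bit_ge0 u : 0 <= half_bit u. Proof. exact: ler0n. Qed.

Lemma half_bit_le u : 0 <= u -> half_bit u <= (2^-1 <= u)%R%:R.
Proof.
move=> u0; rewrite /half_bit ler_nat.
case: (boolP (_ + _ <= u)) => // h.
by rewrite (le_trans _ h)// lerDr.
Qed.

(** The $k$-th summand is the indicator of $k+1/2 \le u < k+1$, so the untruncated sum is the digit
    itself; cutting at $K$ can matter only when $u \ge K$. *)
Lemma half_bit_sum u K : 0 <= u ->
  `|half_bit u -
    \sum_(k < K) ((k%:R + 2^-1 <= u)%R%:R - (k.+1%:R <= u)%R%:R)|
  <= (K%:R <= u)%R%:R.
Proof.
move=> u0; have /andP[n1 n2] := truncn_itv u0.
set n := Num.truncn u in n1 n2 *.
have E (k : nat) : k != n ->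
    (k%:R + 2^-1 <= u)%R%:R - (k.+1%:R <= u)%R%:R = 0 :> R.
  rewrite neq_ltn => /orP[kn|nk].
    have : k.+1%:R <= u by rewrite (le_trans _ n1)// ler_nat.
    rewrite -natr1 => h; rewrite h (_ : _ + 2^-1 <= u) ?subrr//.
    by apply: le_trans h; rewrite lerD2l invf_le1// ler1n.
  have h : u < k%:R by rewrite (lt_le_trans n2)// ler_nat.
  by rewrite !leNgt (lt_le_trans h) ?lerDl// (lt_trans h) ?ltr_nat//= subrr.
have [Kn|nK] := leqP K n.
  have -> : (K%:R <= u)%R by rewrite (le_trans _ n1)// ler_nat.
  rewrite big1 ?subr0 => [|k _]; last first.
    by apply: E; rewrite neq_ltn (leq_trans (ltn_ord k)).
  by rewrite ger0_norm ?half_bit_ge0// ler_nat leq_b1.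
rewrite (bigD1 (Ordinal nK))//= big1 => [|k kn]; last first.
  by apply: E; move: kn; apply: contraNneq => kn; apply/eqP/val_inj.
rewrite -/n /half_bit -/n addr0 (leNgt n.+1%:R) n2 /= subr0 subrr normr0.
exact: ler0n.
Qed.

Lemma sum_natr_le y n : 0 <= y ->
  \sum_(1 <= j < n.+1) (j%:R <= y)%R%:R = (minn (Num.truncn y) n)%:R :> R.
Proof.
move=> y0; elim: n => [|n IHn]; first by rewrite big_geq// minn0.
rewrite big_nat_recr//= IHn -truncn_ge_nat// -natrD; congr (_%:R).
by lia.
Qed.

End FractionalParts.

(** * Sums of fractional parts of a regularly varying sequence *)

Section RegularVariation.
Variable R : realType.

Lemma cvg_ord_sum (T : Type) (D : set_system T) {DF : Filter D} (K : nat)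
    (u : nat -> T -> R) (l : nat -> R) :
  (forall k, (k < K)%N -> u k x @[x --> D] --> l k) ->
  \sum_(k < K) u k x @[x --> D] --> \sum_(k < K) l k.
Proof.
elim: K => [|K IHK] ul.
  rewrite big_ord0 (_ : (fun _ => _) = cst 0); first exact: cvg_cst.
  by apply/funext => x; rewrite big_ord0.
rewrite big_ord_recr/=.
rewrite (_ : (fun _ => _) = fun x => \sum_(k < K) u k x + u K x); last first.
  by apply/funext => x; rewrite big_ord_recr.
by apply: cvgD; [apply: IHK => k kK; apply: ul; lia|apply: ul; lia].
Qed.

(** [G j] stands for the length $g(j)$ and [F] for $f$. [G_F] is the equivalence of $y \le
    h^{-1}(1/j)$ and $j \le 1/h(y)$, the only link between the two. *)
Variables (G : nat -> R) (F : R -> R) (d : R).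
Hypotheses (d_gt0 : 0 < d) (d_lt1 : d < 1).
Hypothesis G_ge0 : forall j, (1 <= j)%N -> 0 <= G j.
Hypothesis F_gt0 : forall x : R, 0 < x -> 0 < F x.
Hypothesis G_F : forall (j : nat) (y : R), (1 <= j)%N -> 0 < y ->
  (y <= G j) = (j%:R <= F y^-1).
Hypothesis F_pinfty : F x @[x --> +oo] --> +oo.
Hypothesis F_regular : forall t : R, 0 < t ->
  F (t * x) / F x @[x --> +oo] --> t `^ d.

Let frac_sum (n : nat) (x : R) : R := \sum_(1 <= j < n.+1) frac_part (x * G j).
Let bit_sum (n : nat) (x : R) : R := \sum_(1 <= j < n.+1) half_bit (x * G j).

Lemma sum_level_count (x v : R) n : 0 < x -> 0 < v ->
  \sum_(1 <= j < n.+1) (v <= x * G j)%R%:R =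
  (minn (Num.truncn (F (x / v))) n)%:R :> R.
Proof.
move=> x0 v0; rewrite -sum_natr_le; last by rewrite ltW// F_gt0 ?divr_gt0.
apply: eq_big_nat => j /andP[j1 _].
by rewrite -ler_pdivrMl// mulrC G_F ?divr_gt0// invf_div.
Qed.

(** A digit $1$ forces $x G_j \ge 1/2$, and the indices with that property are those up to
    $F(2x)$. *)
Lemma bit_sum_le (x : R) n : 0 < x -> bit_sum n x <= F (2 * x).
Proof.
move=> x0; apply: (@le_trans _ _ (\sum_(1 <= j < n.+1) (2^-1 <= x * G j)%R%:R)).
  apply: ler_sum_nat => j /andP[j1 _].
  by apply: half_bit_le; rewrite mulr_ge0 ?G_ge0// ltW.
rewrite sum_level_count// invrK mulrC.
rewrite (le_trans (y := (Num.truncn (F (2 * x)))%:R))//.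
  by rewrite ler_nat geq_minl.
by rewrite truncn_le ltW// F_gt0// mulr_gt0.
Qed.

Lemma frac_sum_double (x : R) n : 0 <= x ->
  2 * frac_sum n x = bit_sum n x + frac_sum n (2 * x).
Proof.
move=> x0; rewrite /frac_sum mulr_sumr -big_split/=.
apply: eq_big_nat => j /andP[j1 _].
by rewrite frac_part_double ?mulrA// mulr_ge0 ?G_ge0.
Qed.

Lemma frac_sum_le_natr (x : R) n : frac_sum n x <= n%:R.
Proof.
rewrite (le_trans (y := \sum_(1 <= j < n.+1) 1))//.
  by apply: ler_sum_nat => j _; apply/ltW/frac_part_lt1.
by rewrite big_const_nat subn1 iter_addr addr0.
Qed.

(** Makes the doubling recursion contracting: each step multiplies [F] by about $2^d$ and divides
    the sum by $2$. *)
Lemma powR2_lt2 : 2 `^ d < 2 :> R.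
Proof.
rewrite /powR pnatr_eq0/= -[ltRHS]lnK ?posrE// ltr_expR gtr_pMl//.
by rewrite ln_gt0 ?ltr1n.
Qed.

(* Potter's bound [F (2 * x) <= kappa * F x] with [2 ^ d < kappa < 2] makes
   the iterated doubling formula a convergent geometric series. *)
Lemma frac_sum_bound : exists C X : R, [/\ 0 <= C, 0 < X &
  forall (x : R) n, X <= x -> frac_sum n x <= C * F x].
Proof.
have q2 := powR2_lt2.
have q0 : 0 < 2 `^ d :> R by rewrite powR_gt0.
pose kappa : R := (2 `^ d + 2) / 2.
have kq : 2 `^ d < kappa by rewrite /kappa; lra.
have k2 : kappa < 2 by rewrite /kappa; lra.
have k0 : 0 < kappa by lra.
have [M [_ MP]] := cvgr_lt _ (F_regular (ltr0n R 2)) _ kq.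
pose X := Num.max M 0 + 1.
have X0 : 0 < X by rewrite ltr_wpDl// le_max lexx orbT.
have XP x : X <= x -> 0 < x /\ F (2 * x) <= kappa * F x.
  move=> Xx; have x0 : 0 < x by exact: lt_le_trans Xx.
  split=> //; rewrite -ler_pdivrMr ?F_gt0// ltW// MP//.
  by rewrite (lt_le_trans _ Xx)// ltr_pwDr// le_max lexx.
(* [C] is the fixed point of $C = (\kappa/2)(1+C)$, so the bound reproduces itself under one
   doubling. *)
pose C := (kappa / 2) / (1 - kappa / 2).
have C0 : 0 <= C by rewrite divr_ge0//; lra.
have CE : (kappa / 2) * (1 + C) = C by rewrite /C; field; lra.
exists C, X; split => // x n Xx; apply/ler_addgt0Pr => e e0.
(* [N] doublings reduce the trivial bound [n] to $n/2^N$; with [n] fixed and $N \to \infty$, what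
   remains does not depend on [n]. *)
have key N y : X <= y -> frac_sum n y <= C * F y + n%:R / 2 ^+ N.
  elim: N y => [|N IHN] y Xy.
    have [y0 _] := XP _ Xy.
    rewrite expr0 divr1 (le_trans (frac_sum_le_natr _ _))// lerDr.
    by rewrite mulr_ge0// ltW// F_gt0.
  have [y0 Fy] := XP _ Xy.
  have h1 := frac_sum_double n (ltW y0); have h2 := bit_sum_le n y0.
  have h3 : frac_sum n (2 * y) <= C * F (2 * y) + n%:R / 2 ^+ N.
    by apply: IHN; lra.
  have h4 : C * F (2 * y) <= C * (kappa * F y) by rewrite ler_wpM2l.
  have -> : n%:R / 2 ^+ N.+1 = (n%:R / 2 ^+ N) / 2 :> R.
    by rewrite exprS; field; rewrite expf_neq0.
  have h5 : C * F y = (kappa / 2) * F y + (kappa / 2) * C * F y.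
    by rewrite -{1}CE; ring.
  lra.
have h2 : `|2^-1| < 1 :> R by rewrite gtr0_norm ?invr_gt0// invf_lt1 ?ltr1n.
have [N _ NP] := cvgr0_norm_le _ (cvg_geometric n%:R h2) _ e0.
have := key N _ Xx; move: (NP N (leqnn _)) => /=.
rewrite exprVn ger0_norm; last by rewrite divr_ge0// exprn_ge0.
lra.
Qed.

(** The digit expansion is summed over $j$; the error counts the indices with $x G_j \ge K$, of
    which there are at most $F(x/K)$. *)
Lemma bit_sum_approx (x : R) n K : (0 < K)%N -> 0 < x ->
  `|bit_sum n x - \sum_(k < K)
      ((minn (Num.truncn (F (x / (k%:R + 2^-1)))) n)%:R -
       (minn (Num.truncn (F (x / k.+1%:R))) n)%:R)| <= F (x / K%:R).
Proof.
move=> K0 x0; have xG j : (1 <= j)%N -> 0 <= x * G j.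
  by move=> j1; rewrite mulr_ge0 ?G_ge0// ltW.
rewrite (eq_bigr (fun k : 'I_K => \sum_(1 <= j < n.+1)
    ((k%:R + 2^-1 <= x * G j)%R%:R - (k.+1%:R <= x * G j)%R%:R))); last first.
  by move=> k _; rewrite sumrB !sum_level_count// ltr_wpDl.
rewrite exchange_big -sumrB/=.
rewrite (le_trans (ler_norm_sum _ _ _))//.
apply: (@le_trans _ _ (\sum_(1 <= j < n.+1) (K%:R <= x * G j)%R%:R)).
  by apply: ler_sum_nat => j /andP[j1 _]; apply: half_bit_sum; exact: xG.
rewrite sum_level_count// ?ltr0n//.
rewrite (le_trans (y := (Num.truncn (F (x / K%:R)))%:R))//.
  by rewrite ler_nat geq_minl.
by rewrite truncn_le ltW// F_gt0// divr_gt0 ?ltr0n.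
Qed.

Lemma truncn_ratio_cvg (v : R) : 0 < v ->
  (Num.truncn (F (x / v)))%:R / F x @[x --> +oo] --> v^-1 `^ d.
Proof.
move=> v0; have h : F (x / v) / F x @[x --> +oo] --> v^-1 `^ d.
  have := F_regular (t := v^-1); rewrite invr_gt0 => /(_ v0).
  by rewrite (_ : (fun x => _) = fun x => F (x / v) / F x)//; apply/funext => x;
    rewrite [_^-1 * x]mulrC.
have x0 : \forall x \near +oo, 0 < x :> R by exact: nbhs_pinfty_gt.
have i0 : (F x)^-1 @[x --> +oo] --> 0.
  by apply/gtr0_cvgV0 => //; apply: filterS x0 => x; exact: F_gt0.
apply: (@squeeze_cvgr _ _ _ _ (fun x => F (x / v) / F x - (F x)^-1)
  (fun x => F (x / v) / F x)) => //.
- near=> x.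
  have xp : 0 < x by near: x.
  have Fv : 0 < F (x / v) by rewrite F_gt0// divr_gt0.
  have /andP[t1 t2] := truncn_itv (ltW Fv).
  rewrite -[X in _ - X]mul1r -mulrBl !ler_pM2r ?invr_gt0 ?F_gt0// t1 andbT.
  by rewrite lerBlDr natr1 ltW.
- by rewrite -[X in _ --> X]subr0; apply: cvgB.
Unshelve. all: by end_near. Qed.

Lemma frac_sum_nondecreasing (x : R) : 0 <= x ->
  {homo frac_sum ^~ x : n m / (n <= m)%N >-> n <= m}.
Proof.
move=> x0; apply/nondecreasing_seqP => n; rewrite /frac_sum [leRHS]big_nat_recr//=.
by rewrite lerDl frac_part_ge0// mulr_ge0 ?G_ge0.
Qed.

Lemma frac_sum_is_cvg : exists C X : R, [/\ 0 <= C, 0 < X &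
  forall x : R, X <= x -> cvgn (frac_sum ^~ x) /\
    0 <= limn (frac_sum ^~ x) <= C * F x].
Proof.
have [C [X [C0 X0 CX]]] := frac_sum_bound.
exists C, X; split => // x Xx; have x0 : 0 <= x by rewrite (le_trans _ Xx)// ltW.
have c : cvgn (frac_sum ^~ x).
  apply: nondecreasing_is_cvgn; first exact: frac_sum_nondecreasing.
  by exists (C * F x) => _ [n _ <-]; exact: CX.
split=> //; apply/andP; split.
  apply: limr_ge => //; apply: nearW => n; rewrite /frac_sum big_seq_cond.
  apply: sumr_ge0 => j; rewrite mem_index_iota andbT => /andP[j1 _].
  by rewrite frac_part_ge0// mulr_ge0 ?G_ge0.
by apply: limr_le => //; apply: nearW => n; exact: CX.
Qed.

Let frac_total (x : R) : R := limn (frac_sum ^~ x).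

(** Passage to the limit $n \to \infty$ for fixed $x$ and $K$: finitely many level counts occur, and
    each is eventually unaffected by the cut at $n$. Beyond [X] the sums converge at both $x$ and
    $2x$. *)
Lemma frac_total_double_approx : exists2 X : R, 0 < X &
  forall (x : R) K, X <= x -> (0 < K)%N ->
  `|2 * frac_total x - frac_total (2 * x) - \sum_(k < K)
      ((Num.truncn (F (x / (k%:R + 2^-1))))%:R -
       (Num.truncn (F (x / k.+1%:R)))%:R)| <= F (x / K%:R).
Proof.
have [C [X [C0 X0 CX]]] := frac_sum_is_cvg.
exists X => // x K Xx K0; have x0 : 0 < x by exact: lt_le_trans Xx.
have [c1 _] := CX _ Xx.
have [c2 _] := CX (2 * x) (ltac:(lra)).
pose c (k n : nat) : R := (minn (Num.truncn (F (x / (k%:R + 2^-1)))) n)%:R -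
       (minn (Num.truncn (F (x / k.+1%:R))) n)%:R.
have cvgc m : (minn m n)%:R @[n --> \oo] --> (m%:R : R).
  apply: cvg_near_cst; exists m => // n /= mn.
  by rewrite (minn_idPl mn).
have L : `|2 * frac_sum n x - frac_sum n (2 * x) - \sum_(k < K) c k n|
    @[n --> \oo] --> `|2 * frac_total x - frac_total (2 * x) - \sum_(k < K)
      ((Num.truncn (F (x / (k%:R + 2^-1))))%:R -
       (Num.truncn (F (x / k.+1%:R)))%:R)|.
  apply: cvg_norm; apply: cvgB.
    by apply: cvgB => //; apply: cvgMl_tmp.
  apply: (cvg_ord_sum (u := c) (l := fun k =>
      (Num.truncn (F (x / (k%:R + 2^-1))))%:R -
       (Num.truncn (F (x / k.+1%:R)))%:R)) => k _.
  by apply: cvgB; exact: cvgc.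
rewrite -(cvg_lim _ L)//; apply: limr_le; first by apply/cvg_ex; eexists; exact: L.
apply: nearW => n; rewrite frac_sum_double ?addrK; last exact: ltW.
exact: bit_sum_approx.
Qed.

Lemma frac_total_double_cvg (alpha : R) :
  \sum_(k < K) ((k%:R + 2^-1)^-1 `^ d - k.+1%:R^-1 `^ d)
    @[K --> \oo] --> alpha ->
  (2 * frac_total x - frac_total (2 * x)) / F x @[x --> +oo] --> alpha.
Proof.
move=> ha; apply/cvgrPdist_le => e e0.
have [X X0 HX] := frac_total_double_approx.
have e4 : 0 < e / 4 by rewrite divr_gt0.
have hK : (K.+1%:R : R)^-1 `^ d @[K --> \oo] --> (0 : R).
  have /cvg_at_rightP := powR_cvg0 d_gt0.
  by apply; split => [n|]; [rewrite invr_gt0 ltr0n|exact: cvg_harmonic].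
(* [K] is fixed before [x]: it makes small both the tail of the series for [alpha] and the limit
   $K^{-d}$ of the truncation error, after which only finitely many limits in [x] remain. *)
have [K [K0 Ka Kd]] : exists K : nat, [/\ (0 < K)%N,
    `|alpha - \sum_(k < K) ((k%:R + 2^-1)^-1 `^ d - k.+1%:R^-1 `^ d)| <= e / 4
    & K%:R^-1 `^ d <= e / 4].
  have [K1 _ H1] := cvgr_dist_le _ _ ha _ e4.
  have [K2 _ H2] := cvgr0_norm_le _ hK _ e4.
  exists (K1 + K2).+1; split => //.
    by apply: H1 => /=; lia.
  have := H2 (K1 + K2)%N; rewrite /= leq_addl => /(_ isT).
  by rewrite ger0_norm ?powR_ge0.
pose c (k : nat) (x : R) : R := (Num.truncn (F (x / (k%:R + 2^-1))))%:R / F x -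
       (Num.truncn (F (x / k.+1%:R)))%:R / F x.
have hc : \sum_(k < K) c k x @[x --> +oo] -->
    \sum_(k < K) ((k%:R + 2^-1)^-1 `^ d - k.+1%:R^-1 `^ d).
  apply: (cvg_ord_sum (u := c)
    (l := fun k => (k%:R + 2^-1)^-1 `^ d - k.+1%:R^-1 `^ d)) => k _.
  by apply: cvgB; apply: truncn_ratio_cvg => //; rewrite ltr_wpDl.
have hF : F (x / K%:R) / F x @[x --> +oo] --> K%:R^-1 `^ d.
  rewrite (_ : (fun x => _) = fun x => F (K%:R^-1 * x) / F x); last first.
    by apply/funext => x; rewrite [_^-1 * x]mulrC.
  by apply: F_regular; rewrite invr_gt0 ltr0n.
near=> x.
have Xx : X <= x by near: x; apply: nbhs_pinfty_ge; exact: num_real.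
have x0 : 0 < x by exact: lt_le_trans Xx.
have Fx := F_gt0 x0.
have h1 : F (x / K%:R) / F x <= e / 4 + e / 4.
  rewrite (le_trans (y := K%:R^-1 `^ d + e / 4)) ?lerD2r//.
  rewrite -lerBlDl (le_trans (ler_norm _))// distrC; near: x.
  exact: cvgr_dist_le hF _ e4.
have h2 : `|\sum_(k < K) ((k%:R + 2^-1)^-1 `^ d - k.+1%:R^-1 `^ d) -
    \sum_(k < K) c k x| <= e / 4.
  by near: x; exact: cvgr_dist_le hc _ e4.
have h3 := HX _ _ Xx K0.
have h4 : `|(2 * frac_total x - frac_total (2 * x)) / F x - \sum_(k < K) c k x|
    <= F (x / K%:R) / F x.
  rewrite /c; under [X in _ - X]eq_bigr do rewrite -mulrBl.
  rewrite -mulr_suml -mulrBl normrM [`|_^-1|]gtr0_norm ?invr_gt0//.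
  by rewrite ler_pM2r ?invr_gt0.
move: h1 h2 h4 Ka; rewrite !ler_norml; lra.
Unshelve. all: by end_near. Qed.

(** With $\tau = T/F$ the doubling formula reads $\tau(x) = A(x)/2 + \tau(2x)B(x)/2$, where $A \to
    \alpha$ and $B \to 2^d$; [L] is the fixed point of the limiting equation. The deviation from [L]
    is followed along $x, 2x, 4x, \dots$, where the ratio $q = 2^d/2 < 1$ and the boundedness of
    $\tau$ remove it. *)
Lemma frac_total_asymptotics (alpha : R) :
  \sum_(k < K) ((k%:R + 2^-1)^-1 `^ d - k.+1%:R^-1 `^ d)
    @[K --> \oo] --> alpha ->
  frac_total x / F x @[x --> +oo] --> alpha / (2 - 2 `^ d).
Proof.
move=> ha; have [C [X [C0 X0 HX]]] := frac_sum_is_cvg.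
pose A (x : R) := (2 * frac_total x - frac_total (2 * x)) / F x.
pose B (x : R) := F (2 * x) / F x.
have hA : A x @[x --> +oo] --> alpha by exact: frac_total_double_cvg.
have hB : B x @[x --> +oo] --> 2 `^ d by exact: F_regular.
have q2 := powR2_lt2; have q0 : 0 < 2 `^ d :> R by rewrite powR_gt0.
set L := alpha / _; set q := 2 `^ d / 2 : R.
have aL : alpha = L * (2 - 2 `^ d) by rewrite /L; field; lra.
pose tau x := frac_total x / F x.
have tauB x : X <= x -> `|tau x| <= C.
  move=> Xx; have [_ /andP[t0 tC]] := HX _ Xx.
  have x0 : 0 < x by exact: lt_le_trans Xx.
  by rewrite ger0_norm ?ler_pdivrMr ?divr_ge0 ?F_gt0// ltW// F_gt0.
have tauE x : 0 < x -> tau x = A x / 2 + tau (2 * x) * B x / 2.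
  move=> x0; rewrite /tau /A /B; field.
  by rewrite !gt_eqF ?F_gt0 ?mulr_gt0.
(* Chosen so that the accumulated errors $e'(1+q+q^2+\cdots)$ sum to $e/2$. Below, [C + 1] replaces
   [C] as a divisor because [C] may vanish. *)
apply/cvgrPdist_le => e e0; pose e' := e * (1 - q) / 2.
have e'0 : 0 < e' by rewrite /e' divr_gt0// mulr_gt0// /q; lra.
have e''0 : 0 < e' / (C + 1) by rewrite divr_gt0//; lra.
have [M1 [_ M1P]] := cvgr_dist_le _ _ hA _ e'0.
have [M2 [_ M2P]] := cvgr_dist_le _ _ hB _ e''0.
pose X1 := Num.max X (Num.max M1 M2 + 1).
have X1P x : X1 <= x -> [/\ X <= x, M1 < x & M2 < x].
  rewrite ge_max => /andP[-> h]; split => //; apply: lt_le_trans h;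
  by rewrite ltr_pwDr// le_max lexx ?orbT.
have step x : X1 <= x -> `|tau x - L| <= e' + q * `|tau (2 * x) - L|.
  move=> /X1P[Xx /M1P ax /M2P bx]; have x0 : 0 < x by exact: lt_le_trans Xx.
  have tC : `|tau (2 * x)| <= C by apply: tauB; lra.
  have -> : tau x - L = (A x - alpha) / 2 + q * (tau (2 * x) - L)
      + tau (2 * x) * (B x - 2 `^ d) / 2.
    by rewrite tauE// aL /q; field.
  rewrite (le_trans (ler_normD _ _))// (le_trans (lerD (ler_normD _ _) (lexx _)))//.
  rewrite [`|q * _|]normrM [`|q|]gtr0_norm ?divr_gt0//.
  rewrite [`|_ / 2|]normrM [`|_ * _ / 2|]normrM [`|tau _ * _|]normrM.
  rewrite [`|2^-1|]gtr0_norm ?invr_gt0//.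
  rewrite ![`|_ - alpha|]distrC ![`|_ - 2 `^ d|]distrC.
  have : `|tau (2 * x)| * `|2 `^ d - B x| <= (C + 1) * (e' / (C + 1)).
    by apply: ler_pM => //; lra.
  by rewrite mulrCA divff ?mulr1; lra.
have key N x : X1 <= x -> `|tau x - L| <= e / 2 + (C + `|L|) * q ^+ N.
  elim: N x => [|N IHN] x X1x.
    rewrite expr0 mulr1 (le_trans (ler_normB _ _))//.
    by rewrite ler_wpDl ?lerD2r ?tauB//; [rewrite divr_ge0 ?ltW|have [] := X1P _ X1x].
  have [Xx _ _] := X1P _ X1x.
  have h1 := step _ X1x; have h2 := IHN (2 * x) (ltac:(lra)).
  have h3 : q * `|tau (2 * x) - L| <= q * (e / 2 + (C + `|L|) * q ^+ N).
    by rewrite ler_wpM2l// ltW// divr_gt0.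
  rewrite (le_trans h1)// (le_trans (lerD (lexx _) h3))//.
  by rewrite le_eqVlt; apply/orP; left; apply/eqP; rewrite exprS /e'; field.
have q1 : `|q| < 1 by rewrite gtr0_norm ?divr_gt0// /q; lra.
have e2 : 0 < e / 2 by rewrite divr_gt0.
have [N _ NP] := cvgr0_norm_le _ (cvg_geometric (C + `|L|) q1) _ e2.
near=> x; have X1x : X1 <= x by near: x; apply: nbhs_pinfty_ge; exact: num_real.
have := key N _ X1x; have := NP N (leqnn _) => /=.
move=> /(le_trans (ler_norm _)) h h'; rewrite distrC; lra.
Unshelve. all: by end_near. Qed.
End RegularVariation.

(** * Complex sequences *)

Section ComplexSequences.
Variable R : realType.
Implicit Types (u v : nat -> R[i]) (l m z : R[i]).
Local Notation normc := (@Normc.normc R).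

Lemma normc_real (x : R) : normc x%:C = `|x|.
Proof. by rewrite /Normc.normc /= expr0n addr0 sqrtr_sqr. Qed.

Lemma normc_imag (x : R) : normc (0 +i* x) = `|x|.
Proof. by rewrite /Normc.normc /= expr0n add0r sqrtr_sqr. Qed.

Lemma normc_ge0 z : 0 <= normc z.
Proof. by case: z => x y; exact: sqrtr_ge0. Qed.

Lemma normc_le z : normc z <= `|complex.Re z| + `|complex.Im z|.
Proof.
rewrite -normc_real -normc_imag.
rewrite [leLHS](_ : _ = normc ((complex.Re z)%:C + 0 +i* complex.Im z)).
  exact: le_normcD.
by congr normc; apply/eqP; rewrite eq_complex /= addr0 add0r !eqxx.
Qed.

Lemma Re_normc_le z : `|complex.Re z| <= normc z.
Proof. by rewrite -lecR normc_ge_Re. Qed.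

Lemma normcX z k : normc (z ^+ k) = normc z ^+ k.
Proof.
elim: k => [|k IHk]; first by rewrite !expr0 Normc.normc1.
by rewrite !exprS Normc.normcM IHk.
Qed.

Lemma normc_sum (I : Type) (r : seq I) (P : pred I) (F : I -> R[i]) :
  normc (\sum_(i <- r | P i) F i) <= \sum_(i <- r | P i) normc (F i).
Proof.
elim/big_ind2 : _ => [|x1 x2 y1 y2 h1 h2|//]; first by rewrite Normc.normc0.
by rewrite (le_trans (le_normcD _ _))// lerD.
Qed.

Lemma ReD z l : complex.Re (z + l) = complex.Re z + complex.Re l.
Proof. by case: z; case: l. Qed.

Lemma ReB z l : complex.Re (z - l) = complex.Re z - complex.Re l.
Proof. by case: z; case: l. Qed.

Lemma Re_sum (I : Type) (r : seq I) (P : pred I) (F : I -> R[i]) :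
  complex.Re (\sum_(i <- r | P i) F i) = \sum_(i <- r | P i) complex.Re (F i).
Proof. by apply: (big_morph (@complex.Re R) ReD (erefl _)). Qed.

Lemma Re_mul_real z (x : R) : complex.Re (z * x%:C) = complex.Re z * x.
Proof. by case: z => a b /=; rewrite mulr0 subr0. Qed.

(** Convergence is expressed through the real modulus [normc], so that limit lemmas over [R] apply;
    the norm of [R[i]] takes its values in [R[i]]. *)
Definition ccvg u l : Prop := normc (u n - l) @[n --> \oo] --> (0 : R).

Lemma ccvg_of_cvg u l : u @ \oo --> (l : R[i]^o) -> ccvg u l.
Proof.
move=> ul; apply/cvgr0Pnorm_lt => e e0.
have e0' : 0 < e%:C :> R[i] by rewrite ltcR.
have : \forall n \near \oo, `|(l : R[i]^o) - u n| < e%:C.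
  exact: (@cvgr_dist_lt R[i] R[i]^o nat \oo _ u l ul e%:C e0').
apply: filterS => n.
rewrite distrC => h; rewrite ger0_norm ?normc_ge0// -ltcR.
exact: h.
Qed.

Lemma ccvg_squeeze u l (e : nat -> R) :
  (forall n, normc (u n - l) <= e n) -> e @ \oo --> (0 : R) -> ccvg u l.
Proof.
move=> ue e0; apply: (squeeze_cvgr (f := cst 0) (h := e)) => //.
  by apply: nearW => n; rewrite normc_ge0 ue.
exact: cvg_cst.
Qed.

Lemma ccvg_cst l : ccvg (fun=> l) l.
Proof. by rewrite /ccvg subrr Normc.normc0; exact: cvg_cst. Qed.

Lemma ccvgD u v l m : ccvg u l -> ccvg v m -> ccvg (fun n => u n + v n) (l + m).
Proof.
move=> ul vm; apply: (ccvg_squeeze (e := fun n => normc (u n - l) + normc (v n - m))).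
  by move=> n; rewrite opprD addrACA le_normcD.
by rewrite -[X in _ --> X]addr0; exact: cvgD.
Qed.

Lemma ccvgM u v l m : ccvg u l -> ccvg v m -> ccvg (fun n => u n * v n) (l * m).
Proof.
move=> ul vm; apply: (ccvg_squeeze (e := fun n =>
  normc (u n - l) * normc (v n - m) + normc l * normc (v n - m)
   + normc m * normc (u n - l))).
  move=> n; rewrite -!Normc.normcM.
  rewrite (_ : u n * v n - l * m = (u n - l) * (v n - m) + l * (v n - m)
    + m * (u n - l)); last by ring.
  by rewrite (le_trans (le_normcD _ _))// lerD2r le_normcD.
rewrite -[X in _ --> X](addr0 0); apply: cvgD; last first.
  by rewrite -[X in _ --> X](mulr0 (normc m)); exact: cvgMl_tmp.
rewrite -[X in _ --> X](addr0 0); apply: cvgD; last first.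
  by rewrite -[X in _ --> X](mulr0 (normc l)); exact: cvgMl_tmp.
by rewrite -[X in _ --> X](mulr0 0); exact: cvgM.
Qed.

Lemma ccvg_sub u v l : ccvg u l -> normc (v n - u n) @[n --> \oo] --> (0 : R) ->
  ccvg v l.
Proof.
move=> ul vu; apply: (ccvg_squeeze (e := fun n => normc (v n - u n) + normc (u n - l))).
  move=> n; rewrite (_ : v n - l = (v n - u n) + (u n - l)) ?le_normcD//.
  by rewrite addrA subrK.
by rewrite -[X in _ --> X]addr0; exact: cvgD.
Qed.

Lemma ccvg_Re u l : ccvg u l -> complex.Re (u n) @[n --> \oo] --> complex.Re l.
Proof.
move=> ul; apply: (cvg_sub0 (g := cst (complex.Re l))); last exact: cvg_cst.
apply: norm_cvg0; apply: (squeeze_cvgr (f := cst 0) (h := fun n => normc (u n - l))) => //.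
  apply: nearW => n; rewrite normr_ge0.
  by have := Re_normc_le (u n - l); rewrite ReB => h; exact: h.
exact: cvg_cst.
Qed.

Lemma ccvg_complex (x y : nat -> R) (a b : R) :
  x @ \oo --> a -> y @ \oo --> b -> ccvg (fun n => x n +i* y n) (a +i* b).
Proof.
move=> xa yb; apply: (ccvg_squeeze (e := fun n => `|x n - a| + `|y n - b|)).
  by move=> n; rewrite (le_trans (normc_le _)).
have h (w : nat -> R) (c : R) : w @ \oo --> c -> `|w n - c| @[n --> \oo] --> (0 : R).
  by move=> wc; rewrite -(normr0 R) -(subrr c); apply: cvg_norm; apply: cvgB => //;
    exact: cvg_cst.
by rewrite -[X in _ --> X](addr0 0); apply: cvgD; exact: h.
Qed.

Lemma ccvg_normc_le u l (M : R) : ccvg u l -> (forall n, normc (u n) <= M) ->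
  normc l <= M.
Proof.
move=> ul uM; rewrite -subr_le0.
have h : normc (u n - l) @[n --> \oo] --> (0 : R) by [].
rewrite -(cvg_lim _ h)//; apply: limr_ge; first by apply/cvg_ex; exists 0.
apply: nearW => n; rewrite lerBlDl -[normc (u n - l)]opprK -/(_ - _).
rewrite opprK (le_trans (y := normc (u n) + normc (u n - l)))//.
  by rewrite -[in leLHS](subrK (u n) l) -(normcN (u n - l)) opprB addrC le_normcD.
by rewrite lerD2r.
Qed.

Lemma ccvg_bounded u l : ccvg u l -> exists M : R, forall n, normc (u n) <= M.
Proof.
move=> ul; have : cvgn (fun n => normc (u n - l)) by apply/cvg_ex; exists 0.
move=> /cvg_seq_bounded [M [_ /(_ (M + 1))]]; rewrite ltrDl ltr01 => /(_ isT) MP.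
exists (M + 1 + normc l) => n; rewrite -[in leLHS](subrK l (u n)).
rewrite (le_trans (le_normcD _ _))// lerD2r.
by have := MP n I; rewrite /= ger0_norm ?normc_ge0.
Qed.

End ComplexSequences.

(** * Power series in a real variable *)

Section PowerSeries.
Variable R : realType.
Implicit Types (phi psi : R -> R[i]) (rho M N t : R).
Local Notation normc := (@Normc.normc R).

(* [M] bounds the l1 norm of the coefficients weighted by the powers of
   [rho], which is submultiplicative. *)
Definition has_psum phi rho M : Prop := exists a : nat -> R[i],
  (forall K, \sum_(k < K) normc (a k) * rho ^+ k <= M) /\
  (forall t, `|t| < rho ->
     ccvg (fun K => \sum_(k < K) a k * t%:C ^+ k) (phi t)).

Lemma has_psum_norm_le phi rho M t : has_psum phi rho M -> `|t| < rho ->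
  normc (phi t) <= M.
Proof.
move=> [a [aM ap]] tr; apply: (ccvg_normc_le (ap _ tr)) => K.
rewrite (le_trans _ (aM K))// (le_trans (normc_sum _ _ _))//.
apply: ler_sum => k _; rewrite Normc.normcM normcX normc_real.
by rewrite ler_wpM2l ?normc_ge0// lerXn2r ?nnegrE ?normr_ge0 ?ltW// (le_lt_trans _ tr).
Qed.

Lemma has_psum_eq phi psi rho M : phi =1 psi -> has_psum phi rho M ->
  has_psum psi rho M.
Proof. by move=> /funext ->. Qed.

Lemma has_psum_le phi rho rho' M M' : 0 <= rho' -> rho' <= rho -> M <= M' ->
  has_psum phi rho M -> has_psum phi rho' M'.
Proof.
move=> r0 rr MM [a [aM ap]]; exists a; split => [K|t tr]; last first.
  by apply: ap; exact: lt_le_trans rr.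
apply: le_trans MM; apply: le_trans (aM K); apply: ler_sum => k _.
by rewrite ler_wpM2l ?normc_ge0// lerXn2r ?nnegrE// (le_trans r0).
Qed.

Lemma has_psum_cst (c : R[i]) rho : has_psum (fun=> c) rho (normc c).
Proof.
exists (fun k => if k is 0%N then c else 0); split => [[|K]|t _].
- by rewrite big_ord0 normc_ge0.
- rewrite big_ord_recl expr0 mulr1 big1 ?addr0// => k _.
  by rewrite Normc.normc0 mul0r.
- rewrite /ccvg; apply: cvg_near_cst; exists 1%N => // -[//|K] _.
  rewrite big_ord_recl expr0 mulr1 big1 ?addr0 ?subrr ?Normc.normc0// => k _.
  by rewrite mul0r.
Qed.

Lemma has_psumD phi psi rho M N : has_psum phi rho M -> has_psum psi rho N ->
  0 <= rho -> has_psum (fun t => phi t + psi t) rho (M + N).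
Proof.
move=> [a [aM ap]] [b [bN bp]] r0; exists (fun k => a k + b k); split => [K|t tr].
  rewrite (le_trans _ (lerD (aM K) (bN K)))// -big_split/=.
  by apply: ler_sum => k _; rewrite -mulrDl ler_wpM2r ?exprn_ge0 ?le_normcD.
rewrite (_ : (fun K => _) = fun K => \sum_(k < K) a k * t%:C ^+ k +
   \sum_(k < K) b k * t%:C ^+ k); first by apply: ccvgD; [exact: ap|exact: bp].
by apply/funext => K; rewrite -big_split; apply: eq_bigr => k _; rewrite mulrDl.
Qed.

Lemma triangular_sum (S : pzRingType) (u v : nat -> S) K :
  \sum_(k < K) \sum_(i < k.+1) u i * v (k - i)%N =
  \sum_(i < K) \sum_(0 <= j < K - i) u i * v j.
Proof.
elim: K => [|K IHK]; first by rewrite !big_ord0.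
rewrite [LHS]big_ord_recr/= IHK [RHS]big_ord_recr/= subSnn big_nat1.
rewrite [X in _ + X = _]big_ord_recr/= subnn addrA; congr (_ + _).
rewrite -big_split/=; apply: eq_bigr => i _.
by rewrite subSn ?big_nat_recr//= ltnW.
Qed.

(** The square of index pairs is cut along the antidiagonal: pairs with $i+j<K$ give the Cauchy
    product, pairs with $i+j \ge K$ the remainder. *)
Lemma ord_sum_mul (S : pzRingType) (u v : nat -> S) K :
  (\sum_(k < K) u k) * (\sum_(k < K) v k) =
  \sum_(k < K) \sum_(i < k.+1) u i * v (k - i)%N +
  \sum_(i < K) \sum_(K - i <= j < K) u i * v j.
Proof.
rewrite triangular_sum big_distrlr -big_split/=; apply: eq_bigr => i _.
by rewrite -(big_mkord xpredT (fun j => u i * v j)) -big_cat_nat ?leq_subr.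
Qed.

(** The weighted norm of the Cauchy product is dominated by the product of the two norms. For
    convergence put $\theta = |t|/\rho < 1$: the remainder involves only $i+j \ge K$, hence is at
    most $MN\theta^K$. *)
Lemma has_psumM phi psi rho M N : has_psum phi rho M -> has_psum psi rho N ->
  0 <= rho -> has_psum (fun t => phi t * psi t) rho (M * N).
Proof.
move=> [a [aM ap]] [b [bN bp]] r0.
pose c k := \sum_(i < k.+1) a i * b (k - i)%N.
have cE (K : nat) (z : R[i]) : \sum_(k < K) c k * z ^+ k =
  \sum_(k < K) \sum_(i < k.+1) (a i * z ^+ i) * (b (k - i)%N * z ^+ (k - i)%N).
  apply: eq_bigr => k _; rewrite /c mulr_suml; apply: eq_bigr => i _.
  by rewrite mulrACA -exprD subnKC// -ltnS.
pose al k := normc (a k) * rho ^+ k; pose be k := normc (b k) * rho ^+ k.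
have al0 k : 0 <= al k by rewrite mulr_ge0 ?normc_ge0 ?exprn_ge0.
have be0 k : 0 <= be k by rewrite mulr_ge0 ?normc_ge0 ?exprn_ge0.
have ab K : (\sum_(k < K) al k) * (\sum_(k < K) be k) <= M * N.
  by apply: ler_pM; [exact: sumr_ge0|exact: sumr_ge0|exact: aM|exact: bN].
exists c; split => [K|t tr].
  apply: le_trans (ab K); rewrite ord_sum_mul.
  apply: (@le_trans _ _ (\sum_(k < K) \sum_(i < k.+1) al i * be (k - i)%N)).
    apply: ler_sum => k _; rewrite /c.
    rewrite (le_trans (ler_wpM2r _ (normc_sum _ _ _))) ?exprn_ge0//.
    rewrite mulr_suml; apply: ler_sum => i _.
    have -> : rho ^+ k = rho ^+ i * rho ^+ (k - i).
      by rewrite -exprD subnKC// -ltnS.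
    by rewrite Normc.normcM /al /be mulrACA lexx.
  by rewrite lerDl; apply: sumr_ge0 => i _; apply: sumr_ge0 => j _; rewrite mulr_ge0.
have rho0 : 0 < rho by exact: le_lt_trans tr.
pose th := `|t| / rho; have th0 : 0 <= th by rewrite divr_ge0.
have th1 : th < 1 by rewrite /th ltr_pdivrMr ?mul1r.
have alE k : normc (a k * t%:C ^+ k) = al k * th ^+ k.
  rewrite Normc.normcM normcX normc_real /al /th exprMn exprVn.
  by rewrite mulrACA mulrA mulfK ?expf_neq0 ?gt_eqF.
have beE k : normc (b k * t%:C ^+ k) = be k * th ^+ k.
  rewrite Normc.normcM normcX normc_real /be /th exprMn exprVn.
  by rewrite mulrACA mulrA mulfK ?expf_neq0 ?gt_eqF.
apply: (ccvg_sub (ccvgM (ap _ tr) (bp _ tr))).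
apply: (squeeze_cvgr (f := cst 0) (h := geometric (M * N) th)).
- apply: nearW => K; rewrite normc_ge0 cE.
  rewrite (ord_sum_mul (fun k => a k * t%:C ^+ k) (fun k => b k * t%:C ^+ k)).
  rewrite opprD addNKr normcN (le_trans (normc_sum _ _ _))//.
  apply: (@le_trans _ _ ((\sum_(i < K) \sum_(K - i <= j < K) al i * be j) * th ^+ K)).
    rewrite mulr_suml; apply: ler_sum => i _.
    rewrite (le_trans (normc_sum _ _ _))// mulr_suml; apply: ler_sum_nat => j.
    move=> /andP[ij jK]; rewrite Normc.normcM alE beE mulrACA -exprD.
    have Kij : (K <= i + j)%N by lia.
    by apply: ler_wpM2l; [rewrite mulr_ge0|exact: (ler_wiXn2l th0 (ltW th1) Kij)].
  apply: ler_wpM2r; first by rewrite exprn_ge0.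
  apply: le_trans (ab K).
  rewrite ord_sum_mul lerDr; apply: sumr_ge0 => i _; apply: sumr_ge0 => j _.
  by rewrite mulr_ge0.
- exact: cvg_cst.
- by apply: cvg_geometric; rewrite ger0_norm.
Qed.

(** Convergence at $r/2$ bounds the terms there: each is a difference of two partial sums bounded by
    [B], hence at most $2B$. At $r/4$ they are dominated by $2B \cdot 2^{-k}$, of sum $4B$. *)
Lemma has_psum_of_cvg (a : nat -> R[i]) phi r : 0 < r ->
  (forall t, `|t| < r -> ccvg (fun K => \sum_(k < K) a k * t%:C ^+ k) (phi t)) ->
  exists rho M, [/\ 0 < rho & has_psum phi rho M].
Proof.
move=> r0 ap; have r2 : `|r / 2| < r by rewrite gtr0_norm; lra.
have [B BP] := ccvg_bounded (ap _ r2).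
have aB k : normc (a k) * (r / 2) ^+ k <= 2 * B.
  have E : a k * (r / 2)%:C ^+ k = \sum_(i < k.+1) a i * (r / 2)%:C ^+ i
      + - \sum_(i < k) a i * (r / 2)%:C ^+ i.
    by rewrite big_ord_recr/= addrAC subrr add0r.
  have <- : normc (a k * (r / 2)%:C ^+ k) = normc (a k) * (r / 2) ^+ k.
    by rewrite Normc.normcM normcX normc_real gtr0_norm ?divr_gt0.
  rewrite E (le_trans (le_normcD _ _))// normcN mulr_natl mulr2n.
  by rewrite lerD.
exists (r / 4), (4 * B); split; first lra.
exists a; split => [K|t tr]; last by apply: ap; lra.
have B0 : 0 <= B by exact: le_trans (normc_ge0 _) (BP 0%N).
have key : \sum_(k < K) normc (a k) * (r / 4) ^+ k <= 4 * B * (1 - 2^-1 ^+ K).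
  elim: K => [|K IHK]; first by rewrite big_ord0 expr0 subrr mulr0.
  rewrite big_ord_recr/= (le_trans (lerD IHK (lexx _)))//.
  have -> : (r / 4) ^+ K = (r / 2) ^+ K * 2^-1 ^+ K.
    by rewrite -exprMn; congr (_ ^+ _); field.
  have h : normc (a K) * (r / 2) ^+ K * 2^-1 ^+ K <= 2 * B * 2^-1 ^+ K.
    by rewrite ler_wpM2r ?exprn_ge0// invr_ge0.
  by rewrite mulrA exprS; lra.
rewrite (le_trans key)// ler_piMr ?mulr_ge0// lerBlDr lerDl exprn_ge0.
Qed.

End PowerSeries.

(** * The complex exponential along a line *)

Section ComplexExponential.
Variable R : realType.
Implicit Types (z w : R[i]) (rho t x y : R).
Local Notation normc := (@Normc.normc R).

(** The $\ell^1$ norm is used because the majorants of $e^{xt}$ and $e^{iyt}$ are $e^{|x|\rho}$ and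
    $e^{|y|\rho}$, with product $e^{(|x|+|y|)\rho}$. *)
Definition norm1 z : R := `|complex.Re z| + `|complex.Im z|.

Lemma complex_ext z w : complex.Re z = complex.Re w ->
  complex.Im z = complex.Im w -> z = w.
Proof. by case: z; case: w => a b c d /= -> ->. Qed.

Lemma cexpD z w : cexp (z + w) = cexp z * cexp w.
Proof.
rewrite /cexp; case: z => a b; case: w => c e /=; rewrite expRD sinD cosD.
by apply: complex_ext => /=; ring.
Qed.

Lemma normc_cexp z : normc (cexp z) = expR (complex.Re z).
Proof.
rewrite /cexp Normc.normcM normc_real ger0_norm ?expR_ge0//.
by rewrite /Normc.normc cos2Dsin2 sqrtr1 mulr1.
Qed.

Lemma sum_complex (a b : nat -> R) K :
  \sum_(k < K) (a k +i* b k) = (\sum_(k < K) a k) +i* (\sum_(k < K) b k).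
Proof.
by elim: K => [|K IHK]; rewrite ?big_ord0// !big_ord_recr/= IHK.
Qed.

(** Removing the constant term leaves the majorant $e^{y\rho}-1$, which is small with [y]; this
    later yields the gain of $1/n$ in differences of consecutive powers. *)
Lemma has_psum_sub1 (b : nat -> R[i]) (phi : R -> R[i]) y rho :
  0 <= y -> 0 <= rho -> b 0%N = 1 -> (forall k, normc (b k) <= y ^+ k / k`!%:R) ->
  (forall t, ccvg (fun K => \sum_(k < K) b k * t%:C ^+ k) (phi t)) ->
  has_psum (fun t => phi t - 1) rho (expR (y * rho) - 1).
Proof.
move=> y0 r0 b0 bM bp; exists (fun k => if k is 0%N then 0 else b k); split.
  move=> [|K]; first by rewrite big_ord0 subr_ge0 -expR0 ler_expR mulr_ge0.
  have yr0 : 0 <= y * rho by rewrite mulr_ge0.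
  have h : series (exp_coeff (y * rho)) K.+1 <= expR (y * rho).
    rewrite /expR; apply: nondecreasing_cvgn_le; last exact: is_cvg_series_exp_coeff.
    apply/nondecreasing_seqP => n; rewrite seriesSr lerDl.
    exact: exp_coeff_ge0.
  rewrite lerBrDr (le_trans _ h)// /series/= big_mkord !big_ord_recl.
  rewrite Normc.normc0 mul0r add0r addrC /exp_coeff/= expr0 divr1 lerD2l.
  apply: ler_sum => k _; rewrite /bump/= add1n exprMn mulrAC.
  by rewrite ler_wpM2r ?exprn_ge0.
move=> t _; apply: (ccvg_sub (ccvgD (bp t) (ccvg_cst (-1)))).
apply: cvg_near_cst; exists 1%N => // -[//|K] _.
by rewrite !big_ord_recl b0 expr0 mul0r add0r mulr1 addrAC subrr add0r subrr
  Normc.normc0.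
Qed.

Lemma exp_psum x rho : 0 <= rho ->
  has_psum (fun t => (expR (x * t))%:C - 1) rho (expR (`|x| * rho) - 1).
Proof.
move=> r0; apply: (has_psum_sub1 (b := fun k => (x ^+ k / k`!%:R)%:C)) => //.
- by rewrite expr0 divr1.
- by move=> k; rewrite normc_real normrM normrX [`|_^-1|]ger0_norm ?invr_ge0.
- move=> t; rewrite (_ : (fun K => _) = fun K => series (exp_coeff (x * t)) K +i* 0).
    by apply: ccvg_complex; [exact: is_cvg_series_exp_coeff|exact: cvg_cst].
  apply/funext => K; transitivity (series (exp_coeff (x * t)) K)%:C => //.
  rewrite /series/= big_mkord rmorph_sum/=; apply: eq_bigr => k _.
  by rewrite -rmorphXn -rmorphM/= /exp_coeff/= exprMn mulrAC.
Qed.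

(** For each $k$ at most one of the cosine and sine coefficients is nonzero, so the complex
    coefficient has modulus at most $|x|^k/k!$. *)
Lemma trig_psum x rho : 0 <= rho ->
  has_psum (fun t => (cos (x * t) +i* sin (x * t)) - 1) rho
           (expR (`|x| * rho) - 1).
Proof.
move=> r0; apply: (has_psum_sub1 (b := fun k => cos_coeff x k +i* sin_coeff x k)) => //.
- by apply: complex_ext; rewrite /= ?cos_coeffE ?sin_coeffE/= ?fact0 ?expr0 ?divr1
    ?mulr1// !mul0r.
- move=> k; apply: le_trans (normc_le _) _; rewrite /= cos_coeffE sin_coeffE /=.
  rewrite !normrM !normrX !normrN1 !expr1n [`|_^-1|]ger0_norm ?invr_ge0//.
  by case: (odd k); rewrite /= normr0 normr1 !mul0r ?addr0 ?add0r !mul1r mulrC.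
- move=> t; rewrite (_ : (fun K => _) = fun K => series (cos_coeff (x * t)) K +i*
      series (sin_coeff (x * t)) K).
    rewrite cos.unlock sin.unlock.
    by apply: ccvg_complex; [exact: is_cvg_series_cos_coeff
      |exact: is_cvg_series_sin_coeff].
  apply/funext => K; rewrite /series/= !big_mkord -sum_complex.
  apply: eq_bigr => k _; rewrite -rmorphXn !cos_coeffE !sin_coeffE /=.
  by apply: complex_ext => /=; rewrite exprMn; ring.
Qed.

(** With $U$ and $V$ the two factors minus $1$, the function is $UV+U+V$, and the bounds $e^a-1$,
    $e^b-1$ combine by the same identity into $e^{a+b}-1$. *)
Lemma cexp_psum w rho : 0 <= rho ->
  has_psum (fun t => cexp (t%:C * w) - 1) rho (expR (norm1 w * rho) - 1).
Proof.
move=> r0; have hU := exp_psum (complex.Re w) r0.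
have hV := trig_psum (complex.Im w) r0.
have := has_psumD (has_psumM hU hV r0) (has_psumD hU hV r0) r0.
rewrite [X in has_psum _ _ X](_ : _ = expR (norm1 w * rho) - 1); last first.
  by rewrite /norm1 [_ * rho in RHS]mulrDl expRD; ring.
apply: has_psum_eq => t; rewrite /cexp.
have -> : complex.Re (t%:C * w) = complex.Re w * t by case: w {hU hV} => a b /=; ring.
have -> : complex.Im (t%:C * w) = complex.Im w * t by case: w {hU hV} => a b /=; ring.
by ring.
Qed.

Lemma normc_cexp_sub1 z : normc (cexp z - 1) <= expR (norm1 z * 2) - 1.
Proof.
have := has_psum_norm_le (cexp_psum z (ler0n R 2)) (t := 1).
by rewrite normr1 mul1r; apply; rewrite ltr1n.
Qed.

Lemma cexp_affine_psum z w rho : 0 <= rho ->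
  has_psum (fun t => cexp (z + t%:C * w)) rho
    (expR (complex.Re z) * expR (norm1 w * rho)).
Proof.
move=> r0; have h := has_psumD (cexp_psum w r0) (has_psum_cst 1 rho) r0.
have := has_psumM (has_psum_cst (cexp z) rho) h r0.
rewrite normc_cexp Normc.normc1 subrK.
by apply: has_psum_eq => t; rewrite subrK cexpD.
Qed.

(** The splitting $e^z(e^{tw}-1)+(e^z-1)$ gives a bound that tends to $0$ with [z] and [w]. *)
Lemma cexp_affine_sub1_psum z w rho : 0 <= rho ->
  has_psum (fun t => cexp (z + t%:C * w) - 1) rho
    (expR (complex.Re z) * (expR (norm1 w * rho) - 1) + (expR (norm1 z * 2) - 1)).
Proof.
move=> r0; have h := has_psumM (has_psum_cst (cexp z) rho) (cexp_psum w r0) r0.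
have := has_psumD h (has_psum_cst (cexp z - 1) rho) r0.
rewrite normc_cexp => h'; apply: (@has_psum_eq _ (fun t =>
  cexp z * (cexp (t%:C * w) - 1) + (cexp z - 1))).
  by move=> t; rewrite cexpD; ring.
by apply: has_psum_le h' => //; rewrite lerD2l normc_cexp_sub1.
Qed.

End ComplexExponential.

(** * Real power series: tails, sums and the identity theorem *)

Section RealPowerSeries.
Variable R : realType.
Implicit Types (phi psi : R -> R) (rho M N t : R).

Definition has_rpsum phi rho M : Prop := exists a : nat -> R,
  (forall K, \sum_(k < K) `|a k| * rho ^+ k <= M) /\
  (forall t, `|t| < rho ->
     \sum_(k < K) a k * t ^+ k @[K --> \oo] --> phi t).

Lemma has_rpsum_Re (f : R -> R[i]) rho M : 0 <= rho -> has_psum f rho M ->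
  has_rpsum (fun t => complex.Re (f t)) rho M.
Proof.
move=> r0 [a [aM ap]]; exists (fun k => complex.Re (a k)); split => [K|t tr].
  rewrite (le_trans _ (aM K))//; apply: ler_sum => k _.
  by rewrite ler_wpM2r ?exprn_ge0// Re_normc_le.
rewrite (_ : (fun K => _) = fun K => complex.Re (\sum_(k < K) a k * t%:C ^+ k)).
  exact: ccvg_Re (ap _ tr).
apply/funext => K; rewrite Re_sum; apply: eq_bigr => k _.
by rewrite -rmorphXn Re_mul_real.
Qed.

Lemma has_rpsum_eq phi psi rho M : (forall t, `|t| < rho -> phi t = psi t) ->
  has_rpsum phi rho M -> has_rpsum psi rho M.
Proof.
by move=> pp [a [aM ap]]; exists a; split => // t tr; rewrite -pp//; exact: ap.
Qed.

Lemma has_rpsum_le phi rho rho' M : 0 <= rho' -> rho' <= rho ->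
  has_rpsum phi rho M -> has_rpsum phi rho' M.
Proof.
move=> r0 rr [a [aM ap]]; exists a; split => [K|t tr]; last first.
  by apply: ap; exact: lt_le_trans rr.
apply: le_trans (aM K); apply: ler_sum => k _.
by rewrite ler_wpM2l// lerXn2r ?nnegrE// (le_trans r0).
Qed.

Lemma has_rpsumB phi psi rho M N : 0 <= rho ->
  has_rpsum phi rho M -> has_rpsum psi rho N ->
  has_rpsum (fun t => phi t - psi t) rho (M + N).
Proof.
move=> r0 [a [aM ap]] [b [bN bp]]; exists (fun k => a k - b k); split => [K|t tr].
  rewrite (le_trans _ (lerD (aM K) (bN K)))// -big_split/=.
  by apply: ler_sum => k _; rewrite -mulrDl ler_wpM2r ?exprn_ge0 ?ler_normB.
rewrite (_ : (fun K => _) = fun K => \sum_(k < K) a k * t ^+ k -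
   \sum_(k < K) b k * t ^+ k); first by apply: cvgB; [exact: ap|exact: bp].
by apply/funext => K; rewrite -sumrB; apply: eq_bigr => k _; rewrite mulrBl.
Qed.

(** Each omitted term is at most $|a_k|\rho^k(|t|/\rho)^K$. The estimate depends on the series only
    through [M] and [rho]: it bounds values (case $K=0$), permits exchanges of limits and isolates
    leading coefficients. *)
Lemma rpsum_tail (a : nat -> R) (l rho M t : R) K :
  (forall K, \sum_(k < K) `|a k| * rho ^+ k <= M) -> `|t| < rho ->
  \sum_(k < K) a k * t ^+ k @[K --> \oo] --> l ->
  `|l - \sum_(k < K) a k * t ^+ k| <= M * (`|t| / rho) ^+ K.
Proof.
move=> aM tr al; have rho0 : 0 < rho by exact: le_lt_trans tr.
set th := `|t| / rho; have th0 : 0 <= th by rewrite divr_ge0// ltW.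
have th1 : th < 1 by rewrite /th ltr_pdivrMr ?mul1r.
have h : `|\sum_(k < n) a k * t ^+ k - \sum_(k < K) a k * t ^+ k| @[n --> \oo] -->
    `|l - \sum_(k < K) a k * t ^+ k|.
  by apply: cvg_norm; apply: cvgB => //; exact: cvg_cst.
rewrite -(cvg_lim _ h)//; apply: limr_le; first by apply/cvg_ex; eexists; exact: h.
exists K => // n /= Kn.
rewrite -(big_mkord xpredT (fun k => a k * t ^+ k)).
rewrite -(big_mkord xpredT (fun k => a k * t ^+ k)) (big_cat_nat (leq0n K) Kn)//= addrAC subrr.
rewrite add0r (le_trans (ler_norm_sum _ _ _))//.
apply: (@le_trans _ _ (\sum_(K <= k < n) (`|a k| * rho ^+ k) * th ^+ K)).
  apply: ler_sum_nat => k /andP[Kk _]; rewrite normrM normrX.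
  have -> : `|t| ^+ k = rho ^+ k * th ^+ k.
    by rewrite -exprMn /th mulrC mulfVK// gt_eqF.
  rewrite mulrA; apply: ler_wpM2l; first by rewrite mulr_ge0// exprn_ge0// ltW.
  exact: (ler_wiXn2l th0 (ltW th1) Kk).
rewrite -mulr_suml; apply: ler_wpM2r; first exact: exprn_ge0.
rewrite (le_trans _ (aM n))// -(big_mkord xpredT (fun k => `|a k| * rho ^+ k)).
rewrite (big_cat_nat (leq0n K) Kn)//= lerDr; apply: sumr_ge0 => k _.
by rewrite mulr_ge0// exprn_ge0// ltW.
Qed.

Lemma nneg_sums_cvg (u : nat -> R) (B : R) : (forall n, 0 <= u n) ->
  (forall n, \sum_(k < n) u k <= B) -> cvgn (fun n => \sum_(k < n) u k).
Proof.
move=> u0 uB; apply: nondecreasing_is_cvgn.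
  by apply/nondecreasing_seqP => n; rewrite big_ord_recr/= lerDl.
by exists B => _ [n _ <-].
Qed.

Lemma abs_sums_cvg (u v : nat -> R) (B : R) : (forall n, `|u n| <= v n) ->
  (forall n, \sum_(k < n) v k <= B) -> cvgn (fun n => \sum_(k < n) u k).
Proof.
move=> uv vB; have h : cvgn (fun n => \sum_(k < n) `|u k|).
  apply: (@nneg_sums_cvg (fun k => `|u k|) B) => // n; rewrite (le_trans _ (vB n))//.
  by apply: ler_sum.
suff : cvgn (series u) by rewrite seriesEord.
apply: (@normed_cvg R R^o u); rewrite (_ : [normed series u] = fun n =>
  \sum_(k < n) `|u k|)//.
by apply/funext => n; rewrite /= seriesEord.
Qed.

(** Coefficients are summed degree by degree, using $|a_{n,k}| \le M_n/\rho^k$. The tail bound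
    $B(|t|/\rho)^K$ holds for every partial sum over $n$, which lets the two limits be exchanged. *)
Lemma rpsum_series (f : nat -> R -> R) rho (M : nat -> R) (B : R) :
  0 < rho -> (forall n, has_rpsum (f n) rho (M n)) ->
  (forall n, \sum_(k < n) M k <= B) ->
  (forall t, `|t| < rho -> cvgn (fun n => \sum_(k < n) f k t)) /\
  has_rpsum (fun t => limn (fun n => \sum_(k < n) f k t)) rho B.
Proof.
move=> r0 /choice[a aP] MB.
have fM n t : `|t| < rho -> `|f n t| <= M n.
  move=> tr; have := rpsum_tail 0 (aP n).1 tr ((aP n).2 _ tr).
  by rewrite big_ord0 subr0 expr0 mulr1.
have fc t : `|t| < rho -> cvgn (fun n => \sum_(k < n) f k t).
  by move=> tr; apply: (@abs_sums_cvg (fun k => f k t) M B) => // n; exact: fM.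
split => //.
have ak k : cvgn (fun n => \sum_(i < n) a i k).
  apply: (@abs_sums_cvg (fun n => a n k) (fun n => M n / rho ^+ k) (B / rho ^+ k)) => n.
    rewrite ler_pdivlMr ?exprn_gt0// (le_trans _ ((aP n).1 k.+1))//.
    rewrite big_ord_recr/= lerDr; apply: sumr_ge0 => i _.
    by rewrite mulr_ge0// exprn_ge0// ltW.
  by rewrite -mulr_suml ler_pM2r ?invr_gt0 ?exprn_gt0.
pose A k := limn (fun n => \sum_(i < n) a i k).
exists A; split => [K|t tr].
  have h : \sum_(k < K) `|\sum_(i < n) a i k| * rho ^+ k @[n --> \oo] -->
      \sum_(k < K) `|A k| * rho ^+ k.
    apply: (cvg_ord_sum (u := fun k n => `|\sum_(i < n) a i k| * rho ^+ k)
      (l := fun k => `|A k| * rho ^+ k)) => k _.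
    by apply: cvgMr_tmp; apply: cvg_norm; exact: ak.
  rewrite -(cvg_lim _ h)//; apply: limr_le; first by apply/cvg_ex; eexists; exact: h.
  apply: nearW => n; rewrite (le_trans _ (MB n))//.
  apply: (@le_trans _ _ (\sum_(k < K) \sum_(i < n) `|a i k| * rho ^+ k)).
    apply: ler_sum => k _; rewrite -mulr_suml ler_wpM2r ?ler_norm_sum//.
    by rewrite exprn_ge0// ltW.
  by rewrite exchange_big; apply: ler_sum => i _; exact: (aP i).1.
have th0 : 0 <= `|t| / rho by rewrite divr_ge0// ltW.
have th1 : `|t| / rho < 1 by rewrite ltr_pdivrMr ?mul1r.
apply/cvgrPdist_le => e e0.
have h1 : `| `|t| / rho| < 1 by rewrite ger0_norm.
have [N _ NP] := cvgr0_norm_le _ (cvg_geometric B h1) _ e0.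
exists N => // K /= /NP /(le_trans (ler_norm _)); apply: le_trans.
have h : `|\sum_(i < n) f i t - \sum_(k < K) (\sum_(i < n) a i k) * t ^+ k|
   @[n --> \oo] --> `|limn (fun n => \sum_(k < n) f k t) - \sum_(k < K) A k * t ^+ k|.
  apply: cvg_norm; apply: cvgB; first exact: fc.
  apply: (cvg_ord_sum (u := fun k n => (\sum_(i < n) a i k) * t ^+ k)
    (l := fun k => A k * t ^+ k)) => k _.
  by apply: cvgMr_tmp; exact: ak.
rewrite -(cvg_lim _ h)//; apply: limr_le; first by apply/cvg_ex; eexists; exact: h.
apply: nearW => n.
under [X in _ - X]eq_bigr do rewrite mulr_suml.
rewrite exchange_big -sumrB (le_trans (ler_norm_sum _ _ _))//.
apply: (@le_trans _ _ (\sum_(i < n) M i * (`|t| / rho) ^+ K)).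
  by apply: ler_sum => i _; apply: rpsum_tail => //; [exact: (aP i).1|exact: (aP i).2].
by rewrite -mulr_suml; apply: ler_wpM2r; rewrite ?exprn_ge0.
Qed.

(** Once the lower coefficients vanish, a zero at small $t>0$ gives $|a_k|t^k \le ct^{k+1}$, and $t
    \to 0$ forces $a_k = 0$. *)
Lemma rpsum_zero phi rho M r : 0 < rho -> 0 < r -> has_rpsum phi rho M ->
  (forall t, 0 < t -> t < r -> phi t = 0) -> forall t, `|t| < rho -> phi t = 0.
Proof.
move=> rho0 r0 [a [aM ap]] p0.
have M0 : 0 <= M by have := aM 0%N; rewrite big_ord0.
have a0 k : a k = 0.
  elim/ltn_ind: k => k IHk; apply/eqP; rewrite -normr_le0.
  apply/ler_addgt0Pr => e e0; rewrite add0r.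
  pose c := M / rho ^+ k.+1; have c0 : 0 <= c by rewrite divr_ge0// exprn_ge0// ltW.
  pose t := Num.min (Num.min (r / 2) (rho / 2)) (e / (c + 1)).
  have t0 : 0 < t by rewrite !lt_min !divr_gt0//; lra.
  have tr : t < r by rewrite !gt_min; apply/orP; left; apply/orP; left; lra.
  have trho : `|t| < rho.
    by rewrite gtr0_norm// !gt_min; apply/orP; left; apply/orP; right; lra.
  have te : t * (c + 1) <= e.
    by rewrite -ler_pdivlMr; [rewrite !ge_min lexx orbT|lra].
  have := rpsum_tail k.+1 aM trho (ap _ trho).
  rewrite p0// big_ord_recr/= big1 ?add0r => [|i _]; last by rewrite IHk ?mul0r.
  rewrite ?sub0r normrN normrM normrX [`|t|]gtr0_norm//.
  have -> : M * (t / rho) ^+ k.+1 = c * t * t ^+ k.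
    by rewrite /c expr_div_n [t ^+ k.+1]exprS; ring.
  by rewrite ler_pM2r ?exprn_gt0//; lra.
move=> t tr; rewrite -(cvg_lim _ (ap _ tr))// (_ : (fun K => _) = cst 0) ?lim_cst//.
by apply/funext => K; rewrite big1// => k _; rewrite a0 mul0r.
Qed.

(** Let [c] be the infimum of the nonnegative points beyond which [phi] vanishes. The expansion at
    [c] vanishes to the right, hence on a full neighbourhood. If $c>0$ this contradicts the choice
    of [c]; so $c=0$, and the expansion there covers the point $0$ itself. *)
Lemma rpsum_continuation phi (t1 : R) : t1 < 1 ->
  (forall t, 0 <= t -> exists rho M, 0 < rho /\ has_rpsum (fun s => phi (t + s)) rho M) ->
  (forall t, t1 < t -> phi t = 0) -> phi 0 = 0.
Proof.
move=> t11 pan p1.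
pose S : set R := [set t | 0 <= t /\ forall s, t < s -> phi s = 0].
have S1 : S (Num.max t1 0).
  by split => [|s]; rewrite ?le_max ?lexx ?orbT// gt_max => /andP[/p1].
have Slb : lbound S 0 by move=> t [].
have hS : has_inf S by split; [exists (Num.max t1 0)|exists 0].
pose c := inf S; have c0 : 0 <= c by apply: lb_le_inf => //; exists (Num.max t1 0).
have cS s : c < s -> phi s = 0.
  move=> cs; have sc : 0 < s - c by rewrite subr_gt0.
  have [t [_ tS] ts] := inf_adherent sc hS.
  by apply: tS; move: ts; rewrite /c; lra.
have [rho [M [rho0 pc]]] := pan _ c0.
have pc0 t : `|t| < rho -> phi (c + t) = 0.
  by apply: (rpsum_zero rho0 rho0 pc) => s s0 _; apply: cS; rewrite ltrDl.
have [c00|cpos] := leP c 0.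
  by have := pc0 (- c); rewrite subrr; apply; rewrite (_ : c = 0) ?oppr0 ?normr0//; lra.
have c'S : S (Num.max 0 (c - rho / 2)).
  split; first by rewrite le_max lexx.
  move=> s; rewrite gt_max => /andP[s0 sc].
  have [cs|cs] := ltP c s; first exact: cS.
  have := pc0 (s - c); rewrite [c + _]addrC subrK; apply.
  by rewrite ler0_norm; lra.
have := inf_lbound (ex_intro _ 0 Slb) c'S; rewrite -/c le_max => /orP[|]; lra.
Qed.

End RealPowerSeries.

(** * The zeta function on a segment *)

Section ZetaOnSegment.
Variable R : realType.
Local Notation normc := (@Normc.normc R).

(** The series $\sum (n+1)^{-1-\epsilon}$ is compared with a telescoping one: for
    $b_n=(n+1)^{-\epsilon}$, $b_{n+1}/(n+2) \le \epsilon^{-1}(b_n-b_{n+1})$ follows from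
    $\ln(n+2)-\ln(n+1) \ge 1/(n+2)$ and $e^x \ge 1+x$. *)
Lemma sum_riemann_le (ep : R) N : 0 < ep ->
  \sum_(n < N) expR (- (ep * ln n.+1%:R)) / n.+1%:R <= 1 + ep^-1.
Proof.
move=> ep0; pose b n : R := expR (- (ep * ln n.+1%:R)).
have key n : \sum_(k < n.+1) b k / k.+1%:R <= 1 + ep^-1 * (1 - b n).
  elim: n => [|n IHn].
    by rewrite big_ord1 /b ln1 mulr0 oppr0 expR0 subrr mulr0 addr0 divr1.
  rewrite big_ord_recr/= (le_trans (lerD IHn (lexx _)))//.
  suff h : b n.+1 / n.+2%:R <= ep^-1 * (b n - b n.+1).
    apply: le_trans (lerD (lexx _) h) _.
    by rewrite le_eqVlt; apply/orP; left; apply/eqP; ring.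
  rewrite ler_pdivlMl//.
  have l0 : n.+2%:R^-1 <= ln n.+2%:R - ln n.+1%:R :> R.
    rewrite -ln_div ?posrE// -[leRHS]opprK -lnV ?posrE ?divr_gt0// invf_div.
    rewrite lerNr (_ : n.+1%:R / n.+2%:R = 1 + (- n.+2%:R^-1)).
      by apply: le_ln1Dx; rewrite ltrN2 invf_lt1// ltr1n.
    rewrite -[in LHS](addrK 1 n.+1%:R) natr1 mulrBl divff ?mul1r//.
  have -> : b n = b n.+1 * expR (ep * (ln n.+2%:R - ln n.+1%:R)).
    by rewrite /b -expRD; congr expR; ring.
  rewrite -[X in _ - X]mulr1 -mulrBr mulrCA ler_wpM2l ?expR_ge0//.
  rewrite lerBrDl (le_trans _ (expR_ge1Dx _))// lerD2l ler_wpM2l// ltW//.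
case: N => [|N]; first by rewrite big_ord0 addr_ge0 ?invr_ge0// ltW.
rewrite (le_trans (key N))// lerD2l ler_piMr ?invr_ge0 ?(ltW ep0)//.
by rewrite lerBlDr lerDl expR_ge0.
Qed.

Lemma expR_sub1_le (x y : R) : 0 <= x -> x <= y -> expR x - 1 <= x * expR y.
Proof.
move=> x0 xy; have h : 1 - x <= expR (- x) by rewrite (le_trans _ (expR_ge1Dx _)).
apply: (@le_trans _ _ (x * expR x)); last by rewrite ler_wpM2l ?ler_expR.
have e0 := expR_gt0 x.
have : (1 - x) * expR x <= expR (- x) * expR x by rewrite ler_pM2r.
by rewrite -expRD addNr expR0; lra.
Qed.

(** Consecutive terms of the Dirichlet eta series are paired, which makes the series absolutely
    convergent on all of $\mathrm{Re}\,s > 0$. *)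
Definition eta_term (n : nat) (s : R[i]) : R[i] :=
  nat_cpowN n.*2.+1 s - nat_cpowN n.*2.+2 s.

Lemma nat_cpowNM m n (s : R[i]) : (0 < m)%N -> (0 < n)%N ->
  nat_cpowN (m * n) s = nat_cpowN m s * nat_cpowN n s.
Proof.
move=> m0 n0; rewrite /nat_cpowN natrM lnM ?posrE ?ltr0n// -cexpD.
by congr cexp; rewrite rmorphD; ring.
Qed.

(** The even-numbered terms of the zeta series are $2^{-s}$ times the whole series; subtracting them
    twice from the first $2N$ terms leaves [N] pairs. *)
Lemma eta_sum (zeta : R[i] -> R[i]) (s : R[i]) :
  series (fun k => nat_cpowN k.+1 s : R[i]^o) @ \oo --> (zeta s : R[i]^o) ->
  ccvg (fun N => \sum_(n < N) eta_term n s) ((1 - 2 * nat_cpowN 2 s) * zeta s).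
Proof.
move=> /ccvg_of_cvg hz; pose P N := \sum_(k < N) nat_cpowN k.+1 s.
have hP : ccvg P (zeta s).
  move: hz; rewrite seriesEord; exact.
have hP2 : ccvg (fun N => P N.*2) (zeta s).
  apply: (cvg_comp _ _ _ hP) => A [N _ NA]; exists N => // n /= Nn.
  by apply: NA => /=; lia.
have := ccvgD hP2 (ccvgM (ccvg_cst (- (2 * nat_cpowN 2 s))) hP).
rewrite (_ : zeta s + _ = (1 - 2 * nat_cpowN 2 s) * zeta s); last by ring.
congr (ccvg _ _); apply/funext => N; elim: N => [|N IHN].
  by rewrite /P double0 !big_ord0; ring.
rewrite big_ord_recr/= -IHN /P doubleS !big_ord_recr/= /eta_term.
rewrite (_ : nat_cpowN N.*2.+2 s = nat_cpowN 2 s * nat_cpowN N.+1 s); first by ring.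
by rewrite -nat_cpowNM// mul2n doubleS.
Qed.

(** With $m=2n+1$ and $\sigma = s+tw$ the term equals $-m^{-\sigma}((1+1/m)^{-\sigma}-1)$. The
    second factor contributes $O(1/(n+1))$; in the first, the growth caused by $tw$ uses up at most
    half of $\mathrm{Re}\,s$ and leaves $(n+1)^{-\mathrm{Re}\,s/2}$. *)
Lemma eta_term_psum (s w : R[i]) (rho : R) n :
  0 <= rho -> norm1 w * rho <= complex.Re s / 2 -> 0 < complex.Re s ->
  has_psum (fun t => eta_term n (s + t%:C * w)) rho
    ((norm1 w * rho * expR (norm1 w * rho) + norm1 s * 2 * expR (norm1 s * 2)) *
     (expR (- (complex.Re s / 2 * ln n.+1%:R)) / n.+1%:R)).
Proof.
move=> r0 wr s0; set m := n.*2.+1.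
have m0 : 0 < m%:R :> R by rewrite ltr0n.
pose L : R := ln m%:R; pose de : R := ln (m.+1%:R / m%:R).
have L0 : 0 <= L by rewrite ln_ge0// ler1n.
have Ln : ln n.+1%:R <= L by rewrite ler_ln ?posrE// ler_nat /m; lia.
have LE : ln m.+1%:R = L + de by rewrite /de ln_div ?posrE// /L addrC subrK.
have mE : m.+1%:R / m%:R = 1 + m%:R^-1 :> R.
  by rewrite -natr1 mulrDl divff ?gt_eqF// mul1r.
have de0 : 0 <= de by rewrite ln_ge0// mE lerDl invr_ge0 ltW.
have mV0 : 0 < m%:R^-1 :> R by rewrite invr_gt0.
have deV : de <= m%:R^-1 by rewrite /de mE le_ln1Dx//; lra.
have Vn : m%:R^-1 <= n.+1%:R^-1 :> R by rewrite lef_pV2 ?posrE// ler_nat /m; lia.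
have V1 : n.+1%:R^-1 <= 1 :> R by rewrite invf_le1// ler1n.
pose E t := cexp (- (s * L%:C) + t%:C * (- (w * L%:C))).
pose D t := cexp (- (s * de%:C) + t%:C * (- (w * de%:C))) - 1.
have ReM (z : R[i]) (x : R) : complex.Re (- (z * x%:C)) = - (complex.Re z * x).
  by case: z => a b /=; ring.
have n1M (z : R[i]) (x : R) : 0 <= x -> norm1 (- (z * x%:C)) = norm1 z * x.
  move=> x0; case: z => a b; rewrite /norm1 /= !mulr0 subr0 add0r !normrN.
  by rewrite !normrM (ger0_norm x0) mulrDl.
have hE := cexp_affine_psum (- (s * L%:C)) (- (w * L%:C)) r0.
have hD := cexp_affine_sub1_psum (- (s * de%:C)) (- (w * de%:C)) r0.
have h := has_psumM (has_psumM (has_psum_cst (-1) rho) hE r0) hD r0.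
have n10 (z : R[i]) : 0 <= norm1 z by rewrite addr_ge0.
apply: (@has_psum_eq _ (fun t => -1 * E t * D t)).
  move=> t; rewrite /eta_term /nat_cpowN -/m LE /E /D.
  set X := - (s * L%:C) + _; set Y := - (s * de%:C) + _.
  rewrite (_ : - ((s + t%:C * w) * (L + de)%:C) = X + Y); last first.
    by rewrite rmorphD /X /Y; ring.
  rewrite -/L (cexpD X Y) (_ : - ((s + t%:C * w) * L%:C) = X); first by ring.
  by rewrite /X; ring.
apply: has_psum_le h => //; rewrite normcN Normc.normc1 mul1r !ReM !n1M//.
set b := expR (- (_ / 2 * _)); set K1 := _ + _ * _ in |- *.
rewrite (_ : K1 * (b / n.+1%:R) = b * (K1 / n.+1%:R)); last by ring.
have ws : 0 <= norm1 w * rho by rewrite mulr_ge0.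
have deV' : de <= n.+1%:R^-1 by exact: le_trans Vn.
have de1 : de <= 1 by exact: le_trans V1.
have h1 : expR (norm1 w * de * rho) - 1 <=
    norm1 w * rho * expR (norm1 w * rho) / n.+1%:R.
  have x0 : 0 <= norm1 w * de * rho by rewrite !mulr_ge0.
  apply: le_trans (expR_sub1_le (y := norm1 w * rho) x0 _) _.
    by rewrite mulrAC ler_piMr.
  rewrite (_ : norm1 w * de * rho * _ = norm1 w * rho * expR (norm1 w * rho) * de).
    by apply: ler_wpM2l => //; rewrite mulr_ge0 ?expR_ge0.
  by ring.
have h2 : expR (norm1 s * de * 2) - 1 <=
    norm1 s * 2 * expR (norm1 s * 2) / n.+1%:R.
  have x0 : 0 <= norm1 s * de * 2 by rewrite !mulr_ge0.
  apply: le_trans (expR_sub1_le (y := norm1 s * 2) x0 _) _.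
    by rewrite mulrAC ler_piMr ?mulr_ge0.
  rewrite (_ : norm1 s * de * 2 * _ = norm1 s * 2 * expR (norm1 s * 2) * de).
    by apply: ler_wpM2l => //; rewrite !mulr_ge0 ?expR_ge0.
  by ring.
have e1 : 0 <= expR (norm1 w * de * rho) - 1.
  by rewrite subr_ge0 -expR0 ler_expR !mulr_ge0.
have e2 : 0 <= expR (norm1 s * de * 2) - 1.
  by rewrite subr_ge0 -expR0 ler_expR !mulr_ge0.
apply: ler_pM.
- by rewrite mulr_ge0 ?expR_ge0.
- by rewrite addr_ge0 ?mulr_ge0 ?expR_ge0.
- rewrite -expRD ler_expR.
  have a1 : norm1 w * rho * L <= complex.Re s / 2 * L by rewrite ler_wpM2r.
  have a2 : complex.Re s / 2 * ln n.+1%:R <= complex.Re s / 2 * L.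
    by rewrite ler_wpM2l// divr_ge0// ltW.
  lra.
- have h3 : expR (- (complex.Re s * de)) * (expR (norm1 w * de * rho) - 1) <=
      norm1 w * rho * expR (norm1 w * rho) / n.+1%:R.
    apply: le_trans h1; rewrite ler_piMl// -expR0 ler_expR oppr_le0.
    by rewrite mulr_ge0// ltW.
  by apply: le_trans (lerD h3 h2) _; rewrite -mulrDl.
Qed.

Lemma eta_series_rpsum (c w : R[i]) : 0 < complex.Re c -> 0 < norm1 w ->
  exists rho B : R, [/\ 0 < rho,
    forall t, `|t| < rho ->
      cvgn (fun N => \sum_(n < N) complex.Re (eta_term n (c + t%:C * w))) &
    has_rpsum (fun t =>
      limn (fun N => \sum_(n < N) complex.Re (eta_term n (c + t%:C * w)))) rho B].
Proof.
move=> c0 w0; pose rho := complex.Re c / 2 / norm1 w.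
have r0 : 0 < rho by rewrite !divr_gt0.
have wr : norm1 w * rho <= complex.Re c / 2 by rewrite mulrC divfK// gt_eqF.
set K1 := (norm1 w * rho * expR (norm1 w * rho) + norm1 c * 2 * expR (norm1 c * 2)).
have n10 (z : R[i]) : 0 <= norm1 z by rewrite addr_ge0.
clearbody rho; have r0' := ltW r0.
have K10 : 0 <= K1 by apply: addr_ge0; rewrite !mulr_ge0 ?expR_ge0 ?n10.
have hn n := has_rpsum_Re (ltW r0) (eta_term_psum n (ltW r0) wr c0).
have [|h1 h2] := rpsum_series (B := K1 * (1 + (complex.Re c / 2)^-1)) r0 hn.
  move=> N; rewrite -mulr_sumr ler_wpM2l// sum_riemann_le//.
  by rewrite divr_gt0.
by exists rho; eexists; split; [exact: r0|exact: h1|exact: h2].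
Qed.

(** The line $c+tw$ is substituted into the series; the [+ 1] in the radius covers $w=0$. *)
Lemma analytic_at_psum (f : R[i] -> R[i]) (c w : R[i]) : analytic_at f c ->
  exists rho M : R, 0 < rho /\ has_psum (fun t => f (c + t%:C * w)) rho M.
Proof.
move=> [a [r [r0 ap]]]; have w0 : 0 < normc w + 1 by rewrite ltr_wpDl ?normc_ge0.
have [||rho [M [rho0 hp]]] := @has_psum_of_cvg R (fun k => a k * w ^+ k)
  (fun t => f (c + t%:C * w)) (r / (normc w + 1)); last by exists rho, M.
  by rewrite divr_gt0.
move=> t; rewrite ltr_pdivlMr// => tr.
have := ap (c + t%:C * w); rewrite addrAC subrr add0r => H.
have /H/ccvg_of_cvg : `|t%:C * w| < r%:C.
  have h : normc (t%:C * w) < r.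
    rewrite Normc.normcM normc_real; apply: le_lt_trans tr.
    by rewrite ler_wpM2l// lerDl.
  by move: h; rewrite -ltcR.
rewrite seriesEord => h; rewrite (_ : (fun K => _) =
  fun K => \sum_(k < K) a k * (t%:C * w) ^+ k); first exact: h.
by apply/funext => K; apply: eq_bigr => k _; rewrite exprMn; ring.
Qed.

(** Only real parts are continued. This suffices because at $s=d$ the factor $1-2^{1-d}$ is real and
    can be taken out. *)
Lemma eta_real (zeta : R[i] -> R[i]) (d : R) : is_riemann_zeta zeta ->
  0 < d -> d < 1 ->
  \sum_(n < N) (expR (- (d * ln n.*2.+1%:R)) - expR (- (d * ln n.*2.+2%:R)))
    @[N --> \oo] --> (1 - 2 * expR (- (d * ln 2))) * complex.Re (zeta d%:C).
Proof.
move=> [zs za] d0 d1; pose w : R[i] := (2 - d) +i* 1.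
pose s t : R[i] := d%:C + t%:C * w.
have Res t : complex.Re (s t) = d + t * (2 - d) by rewrite /s /=; ring.
have Ims t : complex.Im (s t) = t by rewrite /s /=; ring.
have sD t u : s (t + u) = s t + u%:C * w by rewrite /s rmorphD; ring.
have w0 : 0 < norm1 w by rewrite ltr_wpDl//= normr1.
pose E t := limn (fun N => \sum_(n < N) complex.Re (eta_term n (s t))).
pose Z t := (1 - 2 * nat_cpowN 2 (s t)) * zeta (s t).
have phi0 : complex.Re (Z 0) - E 0 = 0.
  (* $(1-d)/(2-d)$ is the parameter at which $\mathrm{Re}\,s(t) = 1$; beyond it the series of zeta
     is available. *)
  apply: (@rpsum_continuation R (fun t => complex.Re (Z t) - E t)
    ((1 - d) / (2 - d))).
  - by rewrite ltr_pdivrMr; lra.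
  - move=> t t0; have c0 : 0 < complex.Re (s t).
      by rewrite Res ltr_wpDr// mulr_ge0//; lra.
    (* The imaginary part of [s t] is [t], so $s(t)=1$ would force $t=0$ and then $d=1$. *)
    have s1 : s t != 1.
      apply/eqP => st; have := Res t; have := Ims t; rewrite st /= => <-.
      by rewrite mul0r addr0; lra.
    have [r1 [M1 [r10 h1]]] := analytic_at_psum w (za _ s1).
    have [r2 [M2 [r20 _ h2]]] := eta_series_rpsum c0 w0.
    pose r := Num.min r1 r2; have r0 : 0 < r by rewrite lt_min r10.
    have r0' := ltW r0.
    have h1' : has_psum (fun u => zeta (s t + u%:C * w)) r M1.
      by apply: has_psum_le h1 => //; rewrite ge_min lexx.
    have h2' : has_rpsum (fun u => E (t + u)) r M2.
      apply: has_rpsum_le r0' _ _; last first.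
        by apply: has_rpsum_eq h2 => u _; rewrite /E; under eq_fun do rewrite -sD.
      by rewrite ge_min lexx orbT.
    have h3 := cexp_affine_psum (- (s t * (ln 2)%:C)) (- (w * (ln 2)%:C)) r0'.
    have h4 := has_psumM (has_psum_cst (- 2) r) h3 r0'.
    have h5 := has_psumM (has_psumD (has_psum_cst 1 r) h4 r0') h1' r0'.
    have h6 := has_rpsumB r0' (has_rpsum_Re r0' h5) h2'.
    exists r; eexists; split => //; apply: has_rpsum_eq h6 => u _ /=.
    rewrite /Z sD /nat_cpowN; congr (complex.Re (_ * _) - _).
    rewrite (_ : - ((s t + u%:C * w) * (ln 2)%:C) =
      - (s t * (ln 2)%:C) + u%:C * (- (w * (ln 2)%:C))); first by ring.
    by ring.
  - move=> t; rewrite ltr_pdivrMr ?subr_gt0; last by lra.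
    move=> ht; have s1 : 1 < complex.Re (s t) by rewrite Res; lra.
    have := ccvg_Re (eta_sum (zs _ s1)); under eq_fun do rewrite Re_sum.
    by move=> h; apply/eqP; rewrite subr_eq0 eq_sym; apply/eqP; exact: cvg_lim h.
have s0 : s 0 = d%:C by rewrite /s mul0r addr0.
have [r [B [r0 hc _]]] := eta_series_rpsum (c := s 0) (ltac:(by rewrite s0)) w0.
have powE n : nat_cpowN n (d%:C) = (expR (- (d * ln n%:R)))%:C.
  rewrite /nat_cpowN /cexp.
  have -> : complex.Re (- (d%:C * (ln n%:R)%:C)) = - (d * ln n%:R).
    by rewrite /=; ring.
  have -> : complex.Im (- (d%:C * (ln n%:R)%:C)) = 0 by rewrite /=; ring.
  by rewrite cos0 sin0; apply: complex_ext => /=; ring.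
have hE : \sum_(n < N) complex.Re (eta_term n (s 0)) @[N --> \oo] --> E 0.
  by have := hc 0; rewrite normr0 => /(_ r0); under eq_fun do rewrite mul0r addr0.
rewrite (_ : (fun N => _) = fun N => \sum_(n < N) complex.Re (eta_term n (s 0))).
  have -> : (1 - 2 * expR (- (d * ln 2))) * complex.Re (zeta d%:C) = E 0.
    have <- : complex.Re (Z 0) = E 0 by apply/eqP; rewrite -subr_eq0 phi0.
    rewrite mulrC -Re_mul_real /Z s0 powE mulrC; congr (complex.Re (_ * _)).
    by apply: complex_ext => /=; ring.
  exact: hE.
apply/funext => N; apply: eq_bigr => n _.
by rewrite s0 /eta_term !powE ReB.
Qed.

End ZetaOnSegment.

(** * The constant pi_p *)

Section PiP.
Variable R : realType.
Local Notation mu := (@lebesgue_measure R).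

Lemma is_derive_powR_onem (a x : R) : x < 1 ->
  is_derive x (1 : R) (fun s : R => (1 - s) `^ a) (- (a * (1 - x) `^ (a - 1))).
Proof.
move=> x1; have h : is_derive x (1 : R) (fun s : R => 1 - s) (-1).
  have := is_deriveB (is_derive_cst (1 : R) x (1 : R)) (is_derive_id x (1 : R)).
  by rewrite sub0r; exact.
have x1' : 0 < 1 - x by rewrite subr_gt0.
have h1 := is_derive1_powR a x1'.
by have := is_derive1_comp (g := fun s : R => 1 - s) h1 h; rewrite mulrN1; exact.
Qed.

(** The fundamental theorem is applied short of the singular endpoint, to $-(1-s)^{1-q}/(1-q)$; the
    bound does not depend on [e]. *)
Lemma powR_onem_itv_integral_le (q e : R) : 0 < q -> q < 1 -> 0 < e -> e < 1 ->
  (\int[mu]_(s in `[0%R, (1 - e)%R]) ((1 - s) `^ (- q))%:E <= ((1 - q)^-1)%:E)%E.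
Proof.
move=> q0 q1 e0 e1; pose F (s : R) : R := - (1 - q)^-1 * (1 - s) `^ (1 - q).
have dF (x : R) : x < 1 -> is_derive x (1 : R) F ((1 - x) `^ (- q)).
  move=> /(is_derive_powR_onem (1 - q)) h.
  apply: (is_derive_eq (is_deriveZ (- (1 - q)^-1) h)).
  rewrite /GRing.scale/= mulNr mulrN opprK mulrA mulVf ?mul1r; last first.
    by rewrite gt_eqF// subr_gt0.
  by congr (_ `^ _); ring.
have cF (x : R) : x < 1 -> {for x, continuous F}.
  move=> /dF d; apply: differentiable_continuous; apply/derivable1_diffP.
  exact: ex_derive.
have ab : 0 < 1 - e by rewrite subr_gt0.
rewrite (@continuous_FTC2 R _ F)//.
- rewrite -EFinB lee_fin /F subr0 powR1 subKr mulr1.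
  have p0 := powR_ge0 e (1 - q); have q0' : 0 < (1 - q)^-1 by rewrite invr_gt0 subr_gt0.
  have : 0 <= (1 - q)^-1 * e `^ (1 - q) by rewrite mulr_ge0// ltW.
  lra.
- apply: (@derivable_within_continuous R R) => x; rewrite in_itv/= => /andP[_ xe].
  have h := is_derive_powR_onem (- q) (x := x) (ltac:(lra)).
  by case: h => h _; exact: h.
- split => [x /=||]; first rewrite in_itv/= => /andP[_ xe].
  + by have := dF x (ltac:(lra)) => h; exact: ex_derive.
  + by apply: cvg_at_right_filter; apply: cF.
  + by apply: cvg_at_left_filter; apply: cF; lra.
- move=> x /=; rewrite in_itv/= => /andP[_ xe].
  have h := dF x (ltac:(lra)); by rewrite derive1E derive_val.
Qed.

Lemma powR_onem_integral_le (q : R) : 0 < q -> q < 1 ->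
  (\int[mu]_(s in `[0%R, 1%R]) ((1 - s) `^ (- q))%:E <= ((1 - q)^-1)%:E)%E.
Proof.
move=> q0 q1; pose f (s : measurableTypeR R) : \bar R := ((1 - s) `^ (- q))%:E.
have mf (D : set (measurableTypeR R)) : measurable_fun D f.
  apply: (measurable_funS measurableT) => //; apply/measurable_EFinP.
  apply: (measurableT_comp (measurable_powR (- q))).
  by apply: measurable_funB.
rewrite -(integral_itv_bndo_bndc (mf _)).
pose A (n : nat) : set (measurableTypeR R) := `[0, 1 - n.+2%:R^-1]%classic.
have -> : `[0, 1[%classic = \bigcup_n A n.
  apply/seteqP; split => [x /=|x [n _]]; rewrite /A/= !in_itv/= => /andP[x0 x1].
    pose n := Num.truncn (1 - x)^-1; exists n => //=; rewrite in_itv/= x0/=.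
    have d0 : 0 < 1 - x by rewrite subr_gt0.
    rewrite lerBrDl -lerBrDr invf_ple ?posrE// ltW//.
    rewrite (lt_trans (truncnS_gt _))// ltr_nat//.
  by rewrite x0 (le_lt_trans x1)// ltrBlDr ltrDl invr_gt0.
have := ge0_nondecreasing_set_cvg_integral (F := A) (f := f) (mu := mu).
move=> h; have {}h : (\int[mu]_(x in A i) f x)%E @[i --> \oo] -->
    (\int[mu]_(x in \bigcup_i A i) f x)%E.
  apply: h => [m n mn|i|i|i x _]; last by rewrite lee_fin powR_ge0.
  - apply/subsetPset => x; rewrite /A/= !in_itv/= => /andP[-> h]/=.
    by rewrite (le_trans h)// lerD2l lerN2 lef_pV2 ?posrE// ler_nat.
  - exact: measurable_itv.
  - exact: mf.
rewrite -(cvg_lim _ h)//; apply: lime_le; first by apply/cvg_ex; eexists; exact: h.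
apply: nearW => n; apply: powR_onem_itv_integral_le => //.
by rewrite invf_lt1// ltr1n.
Qed.

(** [Rintegral] takes the finite part of an extended real, which would turn an infinite integral
    into $0$, so finiteness is needed as much as positivity. Since $s^p \le s$ on $[0,1)$, the
    integrand is at most $(1-s)^{-1/p}$, integrable as $1/p<1$; it is also at least $1$. *)
Lemma pi_p_gt0 (p : R) : 1 < p -> 0 < pi_p p.
Proof.
move=> p1; have p0 : 0 < p by lra.
rewrite /pi_p !mulr_gt0 ?powR_gt0 ?subr_gt0//.
pose q := p^-1; have q0 : 0 < q by rewrite invr_gt0.
have q1 : q < 1 by rewrite invf_lt1.
pose f (s : measurableTypeR R) : \bar R := ((1 - s `^ p) `^ (- q))%:E.
have mf (D : set (measurableTypeR R)) : measurable_fun D f.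
  apply: (measurable_funS measurableT) => //; apply/measurable_EFinP.
  apply: (measurableT_comp (measurable_powR (- q))).
  by apply: measurable_funB => //; exact: measurable_powR.
have mg (D : set (measurableTypeR R)) :
    measurable_fun D (fun s : measurableTypeR R => ((1 - s) `^ (- q))%:E).
  apply: (measurable_funS measurableT) => //; apply/measurable_EFinP.
  apply: (measurableT_comp (measurable_powR (- q))).
  by apply: measurable_funB.
have sp (s : R) : 0 <= s -> s <= 1 -> s `^ p <= s.
  rewrite le_eqVlt => /orP[/eqP <- _|s0 s1]; first by rewrite powR0 ?gt_eqF.
  by rewrite ge1r_powR ?s0// ltW.
have fi : (\int[mu]_(s in `[0%R, 1%R]) f s <= ((1 - q)^-1)%:E)%E.
  apply: le_trans (powR_onem_integral_le q0 q1).
  rewrite -(integral_itv_bndo_bndc (mf _)) -(integral_itv_bndo_bndc (mg _)).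
  apply: ge0_le_integral => //= [x _|x]; first by rewrite lee_fin powR_ge0.
  rewrite in_itv/= => /andP[x0 x1]; have xp := sp _ x0 (ltW x1).
  rewrite lee_fin !powRN lef_pV2 ?posrE ?powR_gt0//; [|lra|lra].
  by apply: ge0_ler_powR; rewrite ?nnegrE ?(ltW q0)//; lra.
have f1 : (1 <= \int[mu]_(s in `[0%R, 1%R]) f s)%E.
  (* The endpoint is removed because the integrand is $0$ at $s=1$, below the bound $1$. *)
  rewrite -(integral_itv_bndo_bndc (mf _)).
  have -> : (1 = \int[mu]_(s in `[0%R, 1%R[) cst 1 s :> \bar R)%E.
    by rewrite integral_cst//= lebesgue_measure_itv/= lte_fin ltr01 mul1e -EFinB subr0.
  apply: ge0_le_integral => //= x; rewrite in_itv/= => /andP[x0 x1].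
  have xp := sp _ x0 (ltW x1); have xp0 := powR_ge0 x p.
  rewrite lee_fin powRN invf_ge1 ?powR_gt0//; last lra.
  have q1E : 1 `^ q = 1 :> R by rewrite powR1.
  by rewrite -[leRHS]q1E; apply: ge0_ler_powR; rewrite ?nnegrE ?(ltW q0)//; lra.
rewrite /Rintegral fine_gt0//; apply/andP; split.
  by apply: lt_le_trans f1; rewrite lte_fin.
by apply: le_lt_trans fi _; rewrite ltry.
Qed.

End PiP.

(** * Counting functions *)

Section ClassG.
Variables (R : realType) (d : R) (h : R -> R).
Hypothesis hG : class_G d h.

Let h_mono (x y : R) : 0 < x -> x < y -> h x < h y.
Proof. by have [_ _ [+ _ _] _ _] := hG; apply. Qed.

Let h_gt0 (x : R) : 0 < x -> 0 < h x.
Proof. by have [+ _ _ _ _] := hG; apply. Qed.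

Let h_le (x y : R) : 0 < x -> 0 < y -> (h x <= h y) = (x <= y).
Proof.
move=> x0 y0; case: (ltgtP x y) => [xy|yx|->]; rewrite ?lexx//.
  by rewrite ltW// h_mono.
by apply/negbTE; rewrite -ltNge h_mono.
Qed.

Lemma class_G_surj (y : R) : 0 < y -> exists2 x : R, 0 < x & h x = y.
Proof.
move=> y0; have [_ hc [_ h0 hy] _ _] := hG.
have : \forall x \near (0 : R)^'+, 0 < x /\ h x < y.
  near=> x; split; near: x; first exact: nbhs_right_gt.
  exact: (cvgr_lt _ h0).
move=> /filter_ex[a [a0 ay]].
have : \forall x \near +oo, a < x /\ y < h x.
  near=> x; split; near: x; first by apply: nbhs_pinfty_gt; exact: num_real.
  exact: (cvgry_gt hy).
move=> /filter_ex[b [ab yb]].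
have cab : {within `[a, b], continuous h}.
  apply: continuous_in_subspaceT => x; rewrite inE/= in_itv/= => /andP[ax _].
  by apply: hc; exact: lt_le_trans ax.
have [|x] := @IVT R h a b y (ltW ab) cab.
  by rewrite ge_min le_max (ltW ay) (ltW yb) orbT.
by rewrite in_itv/= => /andP[ax _] hx; exists x => //; exact: lt_le_trans ax.
Unshelve. all: by end_near. Qed.

Lemma inv_posP (y : R) : 0 < y -> 0 < inv_pos h y /\ h (inv_pos h y) = y.
Proof.
move=> /class_G_surj[x x0 <-]; rewrite /inv_pos pinvKV//; last first.
  by rewrite inE/= in_itv/= x0.
move=> u v; rewrite !inE/= !in_itv/= !andbT => u0 v0 huv.
have [uv|vu|//] := ltgtP u v; [have := h_mono u0 uv|have := h_mono v0 vu];
  by rewrite huv ltxx.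
Qed.

Let F (x : R) : R := (h x^-1)^-1.

Lemma class_G_F_gt0 (x : R) : 0 < x -> 0 < F x.
Proof. by move=> x0; rewrite invr_gt0 h_gt0// invr_gt0. Qed.

Lemma le_inv_pos (j : nat) (y : R) : (1 <= j)%N -> 0 < y ->
  (y <= inv_pos h j%:R^-1) = (j%:R <= F y^-1).
Proof.
move=> j1 y0; have jp : 0 < j%:R^-1 :> R by rewrite invr_gt0 ltr0n.
have [x0 hx] := inv_posP jp; rewrite -h_le// hx /F invrK.
by rewrite -[in LHS](invrK (h y)) lef_pV2// ?posrE ?invr_gt0 ?h_gt0 ?ltr0n.
Qed.

Lemma inv_pinfty_at_right : (x^-1 : R) @[x --> +oo] --> (0 : R)^'+.
Proof.
move=> A [e /= e0 eA]; exists e^-1; split; first exact: num_real.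
move=> x ex; have x0 : 0 < x by apply: lt_trans ex; rewrite invr_gt0.
apply: eA; rewrite /= ?invr_gt0// sub0r normrN gtr0_norm ?invr_gt0//.
by rewrite invf_plt ?posrE.
Qed.

Lemma class_G_F_pinfty : F x @[x --> +oo] --> +oo.
Proof.
have [_ _ [_ h0 _] _ _] := hG.
have := cvg_comp _ _ inv_pinfty_at_right h0.
have hp : \forall x \near +oo, 0 < h x^-1.
  near=> x; apply: h_gt0; rewrite invr_gt0; near: x; exact: nbhs_pinfty_gt.
by move=> hh; apply/cvgrVy.
Unshelve. all: by end_near. Qed.

(** The ratio is the inverse of $h(t^{-1}u)/h(u)$ at $u=1/x$; the uniform limit is applied on the
    compact set $\{t^{-1}\}$. *)
Lemma class_G_F_regular (t : R) : 0 < t ->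
  F (t * x) / F x @[x --> +oo] --> t `^ d.
Proof.
move=> t0; have [_ _ _ hu _] := hG.
have tV0 : 0 < t^-1 by rewrite invr_gt0.
have sub : [set t^-1] `<=` (`]0, +oo[ : set R) by move=> _ ->; rewrite /= in_itv/= tV0.
have := hu _ (@compact_set1 _ t^-1) sub; rewrite uniform_set1 => hh.
have {hh} hh : h (t^-1 * x) / h x @[x --> 0^'+] --> t^-1 `^ d by exact: hh.
have := cvg_comp _ _ inv_pinfty_at_right hh => /cvgV.
rewrite gt_eqF ?powR_gt0// => /(_ isT).
have -> : (t^-1 `^ d)^-1 = t `^ d.
  by rewrite /powR !gt_eqF// lnV ?posrE// mulrN expRN invrK.
apply: cvg_trans; apply: near_eq_cvg; near=> x.
have x0 : 0 < x by near: x; exact: nbhs_pinfty_gt.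
by rewrite /F /unstable.inv_fun /= !invfM !invrK.
Unshelve. all: by end_near. Qed.

End ClassG.

Section Counting.
Variable R : realType.

Lemma counting_initial (m : nat) :
  counting [set k : nat | (1 <= k)%N /\ (k <= m)%N] = (m%:R)%:E :> \bar R.
Proof.
have -> : [set k : nat | (1 <= k)%N /\ (k <= m)%N] = [set k.+1 | k in `I_m].
  apply/seteqP; split => [k /= [k1 km]|_ [k /= km <-]//].
  by exists k.-1; rewrite /= ?prednK.
have c : ([set k.+1 | k in `I_m] #= `I_m)%card.
  by apply: inj_card_eq => x y _ _ [].
have f : finite_set [set k.+1 | k in `I_m] by apply/finite_setP; exists m.
by rewrite /counting; case: asboolP => // _; rewrite (card_fset_set c).
Qed.

Lemma powR_le (q x y : R) : 0 < q -> 0 <= x -> 0 <= y ->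
  (x `^ q <= y `^ q) = (x <= y).
Proof.
move=> q0 x0 y0; apply/idP/idP => [|xy]; last first.
  by apply: ge0_ler_powR; rewrite ?nnegrE// ltW.
by rewrite !leNgt; apply: contra => yx; apply: gt0_ltr_powR; rewrite ?nnegrE.
Qed.

Lemma plap_eigenvalue_le (p T lambda : R) (k : nat) :
  1 < p -> 0 < T -> 0 < lambda ->
  (plap_eigenvalue p T k <= lambda) = (k%:R <= lambda `^ (1 / p) / pi_p p * T).
Proof.
move=> p1 T0 l0; have p0 : 0 < p by lra.
have pi0 := pi_p_gt0 p1.
have lE : lambda = (lambda `^ (1 / p)) `^ p.
  by rewrite -powRrM divfK ?gt_eqF// powRr1// ltW.
rewrite /plap_eigenvalue; move: (pi_p p) pi0 => P pi0.
rewrite ler_pdivrMr ?powR_gt0// -powRM ?ler0n ?(ltW pi0)//.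
rewrite [in LHS]lE -powRM ?powR_ge0 ?(ltW T0)//.
rewrite powR_le ?mulr_ge0 ?powR_ge0 ?(ltW pi0) ?(ltW T0)//.
by rewrite [_ / _ * T]mulrAC ler_pdivlMr// [k%:R * _]mulrC.
Qed.

Lemma eigencount_itv_pos (p lambda : R) (J : set R) : 1 < p -> 0 < lambda ->
  0 < len J ->
  eigencount_itv p lambda J =
  ((Num.truncn (lambda `^ (1 / p) / pi_p p * len J))%:R)%:E.
Proof.
move=> p1 l0 J0; have pi0 := pi_p_gt0 p1.
have x0 : 0 <= lambda `^ (1 / p) / pi_p p * len J.
  by rewrite !mulr_ge0 ?powR_ge0 ?invr_ge0 ?(ltW pi0) ?(ltW J0).
rewrite /eigencount_itv -counting_initial; congr counting.
by apply/seteqP; split => k /= [k1]; rewrite plap_eigenvalue_le// truncn_ge_nat.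
Qed.

Lemma eigencount_itv_le0 (p lambda : R) (J : set R) : 1 < p -> lambda <= 0 ->
  0 < len J -> eigencount_itv p lambda J = 0%E.
Proof.
move=> p1 l0 J0; have pi0 := pi_p_gt0 p1.
rewrite /eigencount_itv (_ : [set k | _] = set0) ?measure0//.
apply/seteqP; split => // k /= [k1]; apply/negP; rewrite -ltNge.
by rewrite (le_lt_trans l0)// divr_gt0 ?mulr_gt0 ?powR_gt0 ?ltr0n.
Qed.

(** Multiplying the eta identity by $2^d$ turns $(2k+1)^{-d}$ into $(k+1/2)^{-d}$ and $1-2^{1-d}$
    into $2^d-2$. *)
Lemma zeta_alternating_cvg (zeta : R[i] -> R[i]) (d : R) : is_riemann_zeta zeta ->
  0 < d -> d < 1 ->
  \sum_(k < K) ((k%:R + 2^-1)^-1 `^ d - k.+1%:R^-1 `^ d) @[K --> \oo] -->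
    - complex.Re (zeta d%:C) * (2 - 2 `^ d).
Proof.
move=> zP d0 d1; have := eta_real zP d0 d1 => /(cvgMl_tmp (a := 2 `^ d)).
have E2 : 2 `^ d = expR (d * ln 2) :> R by rewrite /powR pnatr_eq0.
rewrite (_ : 2 `^ d * _ = - complex.Re (zeta d%:C) * (2 - 2 `^ d)); last first.
  rewrite E2 expRN; field; exact: lt0r_neq0 (expR_gt0 _).
apply: cvg_trans; apply: near_eq_cvg; apply: nearW => K /=.
rewrite mulr_sumr; apply: eq_bigr => k _.
have pE (x : R) : 0 < x -> x^-1 `^ d = expR (- (d * ln x)).
  by move=> x0; rewrite /powR invr_eq0 gt_eqF// lnV ?posrE// mulrN.
have k0 : 0 < k%:R + 2^-1 :> R by rewrite ltr_wpDl.
rewrite !pE// E2 mulrBr -!expRD.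
have -> : ln (k.*2.+1%:R : R) = ln 2 + ln (k%:R + 2^-1).
  by rewrite -lnM ?posrE//; congr ln; rewrite -natr1 -muln2 natrM; field.
have -> : ln (k.*2.+2%:R : R) = ln 2 + ln k.+1%:R.
  by rewrite -lnM ?posrE ?ltr0n//; congr ln; rewrite -natrM mul2n doubleS.
by congr (expR _ - expR _); ring.
Qed.

End Counting.

(** * Integer parts and summability of the lengths *)

Section FloorSums.
Variables (R : realType) (G : nat -> R) (F : R -> R).
Hypothesis F_gt0 : forall x : R, 0 < x -> 0 < F x.
Hypothesis G_F : forall (j : nat) (y : R), (1 <= j)%N -> 0 < y ->
  (y <= G j) = (j%:R <= F y^-1).

Definition floor_sum (n : nat) (x : R) : R :=
  \sum_(1 <= j < n.+1) (Num.truncn (x * G j))%:R.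

(** For $j > F(x)$ one has $xG_j<1$ and the integer part vanishes, so this finite sum is the whole
    series. *)
Definition floor_total (x : R) : R := floor_sum (Num.truncn (F x)) x.

Lemma floor_sum_stable n (x : R) : 0 < x -> (Num.truncn (F x) <= n)%N ->
  floor_sum n x = floor_total x.
Proof.
move=> x0 Fn; rewrite /floor_total /floor_sum.
rewrite (big_cat_nat (n := (Num.truncn (F x)).+1))//=.
rewrite [X in _ + X]big_nat_cond [X in _ + X]big1 ?addr0// => j /andP[/andP[Fj _] _].
apply/eqP; rewrite pnatr_eq0; apply/eqP/truncn0Pn; rewrite -ler_pdivrMl// mulr1.
rewrite G_F ?invr_gt0 ?invrK//; last by apply: leq_trans Fj.
by rewrite -truncn_ge_nat ?(ltW (F_gt0 x0))// -ltnNge.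
Qed.

Lemma frac_sumE n (x : R) : \sum_(1 <= j < n.+1) frac_part (x * G j) =
  x * (\sum_(1 <= j < n.+1) G j) - floor_sum n x.
Proof. by rewrite mulr_sumr -sumrB. Qed.

(** In $XG_j = \lfloor XG_j\rfloor+\{XG_j\}$ the floor sums are eventually constant, so convergence
    of the fractional sums at one [X] makes the lengths summable; the same identity then evaluates
    the fractional sum at every $x>0$. *)
Lemma total_length_cvg (X : R) : 0 < X ->
  cvgn (fun n => \sum_(1 <= j < n.+1) frac_part (X * G j)) ->
  exists2 L : R, \sum_(1 <= j < n.+1) G j @[n --> \oo] --> L &
    forall x : R, 0 < x ->
      limn (fun n => \sum_(1 <= j < n.+1) frac_part (x * G j)) =
      x * L - floor_total x.
Proof.
move=> X0 /cvg_ex[l /= hl].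
have hN (x : R) : 0 < x -> floor_sum n x @[n --> \oo] --> floor_total x.
  move=> x0; apply: cvg_near_cst; exists (Num.truncn (F x)) => // n /= Fn.
  exact: floor_sum_stable.
have hL : \sum_(1 <= j < n.+1) G j @[n --> \oo] --> X^-1 * (l + floor_total X).
  rewrite (_ : (fun n => _) = fun n => X^-1 *
    (\sum_(1 <= j < n.+1) frac_part (X * G j) + floor_sum n X)).
    by apply: cvgMl_tmp; apply: cvgD => //; exact: hN.
  by apply/funext => n; rewrite frac_sumE subrK mulKf// gt_eqF.
exists (X^-1 * (l + floor_total X)) => // x x0; apply: cvg_lim => //.
rewrite (_ : (fun n => _) = fun n => x * (\sum_(1 <= j < n.+1) G j) - floor_sum n x).
  by apply: cvgB; [exact: cvgMl_tmp|exact: hN].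
by apply/funext => n; rewrite frac_sumE.
Qed.

End FloorSums.

(** * The spectral asymptotics *)

Theorem theorem4p2 (R : realType) (zeta : R[i] -> R[i])
  (zetaP : is_riemann_zeta zeta)
  (p : R) (p_gt1 : 1 < p)
  (a b : nat -> R) (I : nat -> set R)
  (I_itv : forall j : nat, (1 <= j)%N -> I j = `]a j, b j[%classic)
  (I_disj : trivIset [set j : nat | (1 <= j)%N] I)
  (Omega : set R)
  (OmegaE : Omega = \bigcup_(j in [set j : nat | (1 <= j)%N]) I j)
  (d : R) (d_gt0 : 0 < d) (d_lt1 : d < 1)
  (h : R -> R) (hG : class_G d h)
  (g : R -> R) (gE : forall x : R, 0 < x -> g x = inv_pos h (1 / x))
  (I_len : forall j : nat, (1 <= j)%N -> lebesgue_measure (I j) = (g j%:R)%:E)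
  (f : R -> R) (fE : forall x : R, 0 < x -> f x = 1 / h (1 / x)) :
  [/\ (lebesgue_measure Omega < +oo)%E,
      (forall lambda : R, eigencount p lambda I < +oo)%E
    & forall lambda : R,
        fine (eigencount p lambda I) =
          (len Omega / pi_p p * lambda `^ (1 / p)
           + complex.Re (zeta d%:C) / pi_p p `^ d * f (lambda `^ (1 / p)))
          +o_(lambda \near +oo) f (lambda `^ (1 / p))].
Proof.
pose G (j : nat) : R := g j%:R; pose F (x : R) : R := (h x^-1)^-1.
have GE j : (1 <= j)%N -> G j = inv_pos h j%:R^-1.
  by move=> j1; rewrite /G gE ?ltr0n// div1r.
have G_gt0 j : (1 <= j)%N -> 0 < G j.
  move=> j1; rewrite GE//; have [] := inv_posP hG (y := j%:R^-1);
  by rewrite ?invr_gt0 ?ltr0n.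
have fF (x : R) : 0 < x -> f x = F x by move=> x0; rewrite fE// !div1r.
have F_gt0 : forall x : R, 0 < x -> 0 < F x := class_G_F_gt0 hG.
have G_F (j : nat) (y : R) : (1 <= j)%N -> 0 < y -> (y <= G j) = (j%:R <= F y^-1).
  by move=> j1 y0; rewrite GE//; exact: le_inv_pos hG _ _ j1 y0.
have G_ge0 j : (1 <= j)%N -> 0 <= G j by move=> /G_gt0/ltW.
have Freg := class_G_F_regular hG; have Fy := class_G_F_pinfty hG.
have asym := frac_total_asymptotics d_gt0 d_lt1 G_ge0 F_gt0 G_F Fy Freg
  (zeta_alternating_cvg zetaP d_gt0 d_lt1).
have [C [X [_ X0 /(_ X (lexx _))[hX _]]]] :=
  frac_sum_is_cvg d_lt1 G_ge0 F_gt0 G_F Freg.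
have [L SL TL] := total_length_cvg F_gt0 G_F X0 hX.
have pi0 := pi_p_gt0 p_gt1; have p_gt0 : 0 < p by lra.
have lenI j : (1 <= j)%N -> len (I j) = G j by move=> j1; rewrite /len I_len.
have mOmega : lebesgue_measure Omega = L%:E.
  rewrite OmegaE measure_bigcup//; last first.
    by move=> j /= j1; rewrite I_itv//; exact: measurable_itv.
  have hS : \sum_(1 <= j < n.+1) (lebesgue_measure (I j) : \bar R) @[n --> \oo] --> L%:E.
    apply: cvg_EFin.
      apply: nearW => n; rewrite (eq_big_nat _ _ (F2 := fun j => (G j)%:E)) ?sumEFin//.
      by move=> j /andP[j1 _]; rewrite I_len.
    rewrite (_ : _ \o _ = fun n => \sum_(1 <= j < n.+1) G j)//; apply/funext => n /=.
    rewrite (eq_big_nat _ _ (F2 := fun j => (G j)%:E)) ?sumEFin//.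
    by move=> j /andP[j1 _]; rewrite I_len.
  (* The sum over the index set starts at $0$, where the condition $1 \le j$ fails; the shift by one
     exposes that zero term. *)
  apply: cvg_lim => //; rewrite -cvg_shiftS.
  rewrite (_ : (fun n => _) = fun n => \sum_(1 <= j < n.+1) lebesgue_measure (I j))//.
  apply/funext => n /=; rewrite big_mkcond big_ltn//= memNset//= add0e.
  by apply: eq_big_nat => j /andP[j1 _]; rewrite mem_set.
have count_pos (lambda : R) : 0 < lambda ->
    eigencount p lambda I = (floor_total G F (lambda `^ (1 / p) / pi_p p))%:E.
  move=> l0; set x := _ / pi_p p; have x0 : 0 < x by rewrite divr_gt0 ?powR_gt0.
  apply: lim_near_cst => //; exists (Num.truncn (F x)).+1 => // -[//|n] /= Fn.
  rewrite -(floor_sum_stable F_gt0 G_F x0 Fn) /floor_sum -sumEFin.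
  apply: eq_big_nat => j /andP[j1 _].
  by rewrite eigencount_itv_pos ?lenI ?G_gt0.
split.
- by rewrite mOmega ltry.
- move=> lambda; have [l0|l0] := leP lambda 0; last by rewrite count_pos// ltry.
  rewrite /eigencount eseries0 ?ltry// => j j1 _.
  by rewrite eigencount_itv_le0 ?lenI ?G_gt0.
set z := complex.Re _; set P := pi_p p.
pose T (x : R) : R := limn (fun n => \sum_(1 <= j < n.+1) frac_part (x * G j)).
(* Here $x=y/\pi_p$; replacing $F(x)$ by $F(y)$ in the denominator is the source of the factor
   $\pi_p^{-d}$. *)
have TF : T (P^-1 * y) / F y @[y --> +oo] --> - z / P `^ d.
  have hP : P^-1 * y @[y --> +oo] --> +oo.
    by apply: gt0_cvgMry; rewrite ?invr_gt0//; exact: cvg_id.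
  have h1 := cvg_comp _ _ hP asym.
  have h2 : F (P^-1 * y) / F y @[y --> +oo] --> P^-1 `^ d.
    by apply: Freg; rewrite invr_gt0.
  have q2 : 2 - 2 `^ d != 0 :> R by rewrite gt_eqF// subr_gt0 powR2_lt2.
  have := cvgM h1 h2; rewrite mulfK//.
  have -> : P^-1 `^ d = (P `^ d)^-1.
    by rewrite /powR invr_eq0 gt_eqF// lnV ?posrE// mulrN expRN.
  move=> hh; apply: (cvg_trans _ (hh _)); apply: near_eq_cvg; near=> y.
  have y0 : 0 < y by near: y; exact: nbhs_pinfty_gt.
  have x0 : 0 < P^-1 * y by rewrite mulr_gt0// invr_gt0.
  by rewrite /= /T mulrA; congr (_ / _); rewrite [LHS]mulfVK ?gt_eqF ?F_gt0.
have key (eps : R) : 0 < eps -> \forall lambda \near +oo,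
    `|fine (eigencount p lambda I) - (len Omega / P * lambda `^ (1 / p)
           + z / P `^ d * f (lambda `^ (1 / p)))| <= eps * `|f (lambda `^ (1 / p))|.
  move=> e0; have [M [_ MP]] := cvgr_dist_le _ _ TF _ e0.
  (* Ensures $\lambda^{1/p} > |M|+1 > M$, with a positive base whatever the sign of [M]. *)
  exists ((`|M| + 1) `^ p); split; first exact: num_real.
  move=> lambda hl; have l0 : 0 < lambda by rewrite (le_lt_trans _ hl) ?powR_ge0.
  have M1 : 0 <= `|M| + 1 by rewrite addr_ge0.
  set y := lambda `^ (1 / p); have y0 : 0 < y by rewrite powR_gt0.
  have yM : M < y.
    apply: (@le_lt_trans _ _ `|M|); first exact: ler_norm.
    apply: (@lt_trans _ _ (`|M| + 1)); first by rewrite ltrDl.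
    have -> : `|M| + 1 = ((`|M| + 1) `^ p) `^ (1 / p).
      by rewrite -powRrM mulrC divfK ?gt_eqF// powRr1.
    apply: gt0_ltr_powR => //; rewrite ?nnegrE ?powR_ge0 ?(ltW l0)//.
    by rewrite divr_gt0.
  have x0 : 0 < P^-1 * y by rewrite mulr_gt0// invr_gt0.
  have := MP _ yM; rewrite /T TL// fF// count_pos//= -/y /len mOmega/=.
  rewrite [y / P]mulrC; set N := floor_total _ _ _; move=> hle.
  have Fy0 := F_gt0 _ y0; rewrite (gtr0_norm Fy0) -ler_pdivrMr//.
  rewrite -[X in _ / X](gtr0_norm Fy0) -normf_div.
  (* Since $T(x)=xL-N$, the error divided by [F y] is exactly the difference bounded in [hle]. *)
  apply: le_trans hle.
  rewrite le_eqVlt; apply/orP; left; apply/eqP; congr `|_|.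
  by field; rewrite !gt_eqF// powR_gt0.
have := (eqaddoP (pinfty_filter_on R) (fun lambda => fine (eigencount p lambda I))
  (fun lambda => len Omega / P * lambda `^ (1 / p)
           + z / P `^ d * f (lambda `^ (1 / p))) (fun lambda => f (lambda `^ (1 / p)))).2 key.
by rewrite funeqE; exact.
Unshelve. all: by end_near. Qed.
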